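(* In the setting described in the context (splitting type FB or DR, $\gamma\in(0,1/L)$, point $x^0$, candidate set $\mathcal{P}$, region $\Omega$, envelope $F_\gamma$), suppose that the regularity hypothesis (R) of the context holds on $\Omega$, that $\mathcal{P}\subset\mathbb{R}^{n\times n}$ is compact and convex with $I\in\mathcal{P}$, and that $F=f+g$ has bounded sublevel sets. Suppose in addition that there are $x^\star\in\mathbb{R}^n$, $\rho>0$ and $M\in\mathbb{R}^{n\times n}$ with $$T(x)=x^\star+M(x-x^\star)\quad\text{for all }x\in\mathcal{B}(x^\star,\rho)=\{x:\|x-x^\star\|\le\rho\},$$ that $I-M$ is nonsingular and $(I-M)^{-1}\in\mathcal{P}$. Assume that $F_\gamma$ is convex on $\mathbb{R}^n$ and $\mu_\gamma$-strongly convex on $\mathcal{B}(x^\star,\rho)$ for some $\mu_\gamma>0$. For $K\ge1$ run the algorithm OSOP of the context for $K$ iterations with $\beta=0$ and $\eta=\frac{\Delta_{\mathcal{P}}}{G_\ell\sqrt K}$, where $G_\ell=\frac1\gamma+L_\gamma+L_\gamma\Delta_{\mathcal{P}}$. Let $K_0=\min\{k:x^j\in\mathcal{B}(x^\star,\rho)\text{ for all }j\ge k\}$ be the identification index. Then there are constants $C,C'$ independent of $K$ such that $K_0\le C\sqrt K+C'$, and whenever $K>K_0$, $$\|x^K-x^\star\|^2\le\|x^{K_0}-x^\star\|^2\left(\frac{2\|I-M\|^2}{\mu_\gamma}\cdot\frac{\Delta_{\mathcal{P}}G_\ell\sqrt K}{K-K_0}\right)^{K-K_0}.$$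
   Context: Standing setting: $f:\mathbb{R}^n\to\mathbb{R}$ is convex, twice differentiable and $L$-smooth ($L>0$); $g:\mathbb{R}^n\to\mathbb{R}\cup\{+\infty\}$ is proper, closed, convex; $F=f+g$; $\gamma\in(0,1/L)$. For $h$ proper closed convex, $\operatorname{prox}_{\gamma h}(z)=\arg\min_x\{h(x)+\frac1{2\gamma}\|x-z\|^2\}$ and $h_\gamma(z)=\min_x\{h(x)+\frac1{2\gamma}\|x-z\|^2\}$ (Moreau envelope). One of two cases is fixed. FB: $p(x)=x$, $q(x)=\operatorname{prox}_{\gamma g}(x-\gamma\nabla f(x))$, $F_\gamma(x)=f(x)-\frac\gamma2\|\nabla f(x)\|^2+g_\gamma(x-\gamma\nabla f(x))$. DR: $p(x)=\operatorname{prox}_{\gamma f}(x)$, $q(x)=\operatorname{prox}_{\gamma g}(2p(x)-x)$, $F_\gamma(x)=f_\gamma(x)-\gamma\|\nabla f_\gamma(x)\|^2+g_\gamma(x-2\gamma\nabla f_\gamma(x))$. In both cases $T(x)=x-(p(x)-q(x))$. $\|\cdot\|$ is Euclidean/operator norm, $\|\cdot\|_F$ the Frobenius norm. ''$\ell$-smooth on a set'' means gradient $\ell$-Lipschitz there; ''$m$-strongly convex on a convex set'' means $h-\frac m2\|\cdot\|^2$ is convex there. $\Delta_{\mathcal{P}}=\max_{P,P'\in\mathcal{P}}\|P-P'\|_F$. Region: $\mathcal{L}_0=\{x:F_\gamma(x)\le F_\gamma(x^0)\}$ and $\Omega=\operatorname{conv}\big(\mathcal{L}_0\cup\{x-P(x-T(x)):x\in\mathcal{L}_0,P\in\mathcal{P}\}\big)$.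 Regularity hypothesis (R): with $0\le\mu\le L$, either (A) there are a convex set $\Omega_f$ and constants $H,D,G\ge0$ with $\mu I\preceq\nabla^2f\preceq LI$ and $\|\nabla f\|\le D$ on $\Omega_f$, $\nabla^2 f$ $H$-Lipschitz on $\Omega_f$ (operator norm), $g$ $G$-Lipschitz on $\mathbb{R}^n$, and $\Omega\subseteq\Omega_f$ (FB) or $\operatorname{prox}_{\gamma f}(\Omega)\subseteq\Omega_f$ (DR); or (B) $f$ is quadratic with Hessian $Q$, $\mu I\preceq Q\preceq LI$ (then $H(D+G)$ is replaced by $0$ below). The constant $L_\gamma$ is $\frac{1-\gamma\mu}{\gamma}+\gamma H(D+G)$ in the FB case and $\frac{1-\gamma\mu}{\gamma(1+\gamma\mu)^2}+\frac{2\gamma H(D+G)}{(1+\gamma\mu)^3}$ in the DR case. (Under (R), $F_\gamma$ is $L_\gamma$-smooth on $\Omega$.) Feedback (with $\beta=0$): for $x\ne T(x)$, $\ell_x(P)=\frac{F_\gamma(x-P(x-T(x)))-F_\gamma(x)}{\|x-T(x)\|^2}$, $P\in\mathbb{R}^{n\times n}$. Algorithm OSOP (with $\beta=0$): start from $x^0$ and $P_0=I$. For $k=0,1,\dots,K-1$: stop if $x^k=T(x^k)$; set $x^{k+1/2}=x^k-P_k(x^k-T(x^k))$; set $P_{k+1}=\Pi_{\mathcal{P}}[P_k-\eta\nabla\ell_{x^k}(P_k)]$ (Frobenius projection and gradient; explicitly $\nabla\ell_{x^k}(P_k)=-\frac{\nabla F_\gamma(x^{k+1/2})(x^k-T(x^k))^\top}{\|x^k-T(x^k)\|^2}$);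 choose $x^{k+1}\in\arg\min\{F_\gamma(x):x\in\{x^k,x^{k+1/2}\}\}$. It is understood that all $K$ iterations are carried out (no early stop). In the definition of $K_0$ the indices range over $0\le k\le j\le K$, with $K_0=K+1$ if no such $k$ exists. The data $f,g,\gamma,x^0,\mathcal{P}$ (and $\rho,M$) are fixed while $K$ varies; the iterates depend on $K$ through $\eta$. *)

(* Defs.v *)
From mathcomp Require Export all_boot all_order all_algebra.
From mathcomp Require Export all_classical all_reals all_analysis.

Set Implicit Arguments.
Unset Strict Implicit.
Unset Printing Implicit Defensive.

Export Order.TTheory GRing.Theory Num.Theory.
Export numFieldNormedType.Exports.

Global Open Scope classical_set_scope.
Global Open Scope ring_scope.

(* The library's norm on matrices is the sup norm; it is used below only through
   the topology it induces (differentiability, compactness, boundedness, lower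
   semicontinuity), which is the Euclidean one. All metric quantities use fnorm,
   which on 'cV[R]_n is the Euclidean norm. *)
Definition fnorm (R : realType) (m n : nat) (A : 'M[R]_(m, n)) : R :=
  Num.sqrt (\sum_i \sum_j A i j ^+ 2).

Definition opnorm (R : realType) (n : nat) (A : 'M[R]_n) : R :=
  sup [set fnorm (A *m v) | v in [set v : 'cV[R]_n | fnorm v <= 1]].

Definition eball (R : realType) (n : nat) (x : 'cV[R]_n) (r : R) : set 'cV[R]_n :=
  [set y | fnorm (y - x) <= r].

Definition psd (R : realType) (n : nat) (A : 'M[R]_n) : Prop :=
  A^T = A /\ forall v : 'cV[R]_n, 0 <= (v^T *m A *m v) 0 0.

Definition loewner_le (R : realType) (n : nat) (A B : 'M[R]_n) : Prop :=
  psd (B - A).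

(* Gradient for the Frobenius inner product; for n = 1 the Euclidean gradient. *)
Definition grad (R : realType) (m n : nat) (h : 'M[R]_(m, n) -> R)
    (A : 'M[R]_(m, n)) : 'M[R]_(m, n) :=
  \matrix_(i, j) 'D_(delta_mx i j) h A.

Definition hess (R : realType) (n : nat) (h : 'cV[R]_n -> R) (x : 'cV[R]_n) :
    'M[R]_n :=
  \matrix_(i, j) 'D_(delta_mx j 0) (fun y => grad h y i 0) x.

Definition twice_differentiable (R : realType) (n : nat) (h : 'cV[R]_n -> R) :
    Prop :=
  (forall x, differentiable h x) /\ (forall x, differentiable (grad h) x).

Definition smooth (R : realType) (n : nat) (l : R) (h : 'cV[R]_n -> R) : Prop :=
  (forall x, differentiable h x) /\
  (forall x y, fnorm (grad h x - grad h y) <= l * fnorm (x - y)).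

Definition strongly_convex_on (R : realType) (n : nat) (m : R)
    (A : set 'cV[R]_n) (h : 'cV[R]_n -> R) : Prop :=
  @convex_function R 'cV[R]_n A (fun x => h x - m / 2 * fnorm x ^+ 2).

Definition quadratic_with_hessian (R : realType) (n : nat) (Q : 'M[R]_n)
    (h : 'cV[R]_n -> R) : Prop :=
  Q^T = Q /\ exists (b : 'cV[R]_n) (c : R),
    forall x, h x = 2^-1 * (x^T *m Q *m x) 0 0 + (b^T *m x) 0 0 + c.

Definition convex_hull (R : realType) (n : nat) (A : set 'cV[R]_n) :
    set 'cV[R]_n :=
  smallest (@convex_set R 'cV[R]_n) A.

Definition eproper (R : realType) (n : nat) (h : 'cV[R]_n -> \bar R) : Prop :=
  (forall x, h x != -oo%E) /\ (exists x, h x != +oo%E).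

(* Meant for functions that avoid -oo; note that 0 * +oo = 0 in \bar R. *)
Definition econvex (R : realType) (n : nat) (h : 'cV[R]_n -> \bar R) : Prop :=
  forall (x y : 'cV[R]_n) (t : R), 0 <= t <= 1 ->
  (h (t *: x + (1 - t) *: y)%R <= t%:E * h x + (1 - t)%:E * h y)%E.

Definition elipschitz (R : realType) (n : nat) (G : R) (h : 'cV[R]_n -> \bar R) :
    Prop :=
  (forall x, h x \is a fin_num) /\
  (forall x y, `|fine (h x) - fine (h y)| <= G * fnorm (x - y)).

Definition argmin (T : Type) (d : Order.disp_t) (V : porderType d) (A : set T)
    (h : T -> V) : set T :=
  [set x | A x /\ forall y, A y -> (h x <= h y)%O].

Definition prox_obj (R : realType) (n : nat) (gam : R) (h : 'cV[R]_n -> \bar R)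
    (z x : 'cV[R]_n) : \bar R :=
  (h x + ((2 * gam)^-1 * fnorm (x - z) ^+ 2)%:E)%E.

(* For proper closed convex h and gam > 0, the minimizer exists and is unique. *)
Definition prox (R : realType) (n : nat) (gam : R) (h : 'cV[R]_n -> \bar R)
    (z : 'cV[R]_n) : 'cV[R]_n :=
  xget 0 (argmin setT (prox_obj gam h z)).

(* The infimum is finite and attained under the same assumptions. *)
Definition moreau (R : realType) (n : nat) (gam : R) (h : 'cV[R]_n -> \bar R)
    (z : 'cV[R]_n) : R :=
  fine (ereal_inf (range (prox_obj gam h z))).

Definition proj (R : realType) (n : nat) (A : set 'M[R]_n) (Z : 'M[R]_n) :
    'M[R]_n :=
  xget 0 (argmin A (fun Q => fnorm (Q - Z))).

Definition diam (R : realType) (n : nat) (A : set 'M[R]_n) : R :=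
  sup [set d | exists P P', [/\ A P, A P' & d = fnorm (P - P')]].

Inductive splitting : Type := FB | DR.

Section Splitting.
Context (R : realType) (n : nat).
Variables (s : splitting) (f : 'cV[R]_n -> R) (g : 'cV[R]_n -> \bar R) (gam : R).
Implicit Types (x : 'cV[R]_n) (P : 'M[R]_n) (cP : set 'M[R]_n).

Definition pmap_of x : 'cV[R]_n :=
  match s with FB => x | DR => prox gam (EFin \o f) x end.

Definition qmap_of x : 'cV[R]_n :=
  match s with
  | FB => prox gam g (x - gam *: grad f x)
  | DR => prox gam g (2 *: pmap_of x - x)
  end.

Definition split_op x : 'cV[R]_n := x - (pmap_of x - qmap_of x).

Definition envelope x : R :=
  match s with
  | FB => f x - gam / 2 * fnorm (grad f x) ^+ 2
          + moreau gam g (x - gam *: grad f x)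
  | DR => let f_env := moreau gam (EFin \o f) in
          f_env x - gam * fnorm (grad f_env x) ^+ 2
          + moreau gam g (x - (2 * gam) *: grad f_env x)
  end.

Definition pstep x P : 'cV[R]_n := x - P *m (x - split_op x).

Definition region (x0 : 'cV[R]_n) cP : set 'cV[R]_n :=
  let L0 := [set x | envelope x <= envelope x0] in
  convex_hull (L0 `|` [set y | exists x P, [/\ L0 x, cP P & y = pstep x P]]).

(* hdg is the value that stands for H (D + G) in the smoothness constant. Since
   pmap_of is the identity for FB, the inclusion in the first case reads
   Omega `<=` Of for FB and prox_(gam f) (Omega) `<=` Of for DR. *)
Definition regular_on (L mu hdg : R) (Omega : set 'cV[R]_n) : Prop :=
  0 <= mu <= L /\
  ((exists (Of : set 'cV[R]_n) (H D G : R),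
      [/\ 0 <= H, 0 <= D, 0 <= G & hdg = H * (D + G)] /\
      [/\ @convex_set R 'cV[R]_n Of, pmap_of @` Omega `<=` Of & elipschitz G g] /\
      [/\ forall x, Of x ->
            loewner_le mu%:M (hess f x) /\ loewner_le (hess f x) L%:M,
          forall x, Of x -> fnorm (grad f x) <= D &
          forall x y, Of x -> Of y ->
            opnorm (hess f x - hess f y) <= H * fnorm (x - y)])
   \/
   (exists Q : 'M[R]_n,
      [/\ quadratic_with_hessian Q f, loewner_le mu%:M Q, loewner_le Q L%:M
        & hdg = 0])).

Definition envelope_const (mu hdg : R) : R :=
  match s with
  | FB => (1 - gam * mu) / gam + gam * hdg
  | DR => (1 - gam * mu) / (gam * (1 + gam * mu) ^+ 2)
          + 2 * gam * hdg / (1 + gam * mu) ^+ 3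
  end.

Definition feedback x P : R :=
  (envelope (pstep x P) - envelope x) / fnorm (x - split_op x) ^+ 2.

(* A complete run of K iterations, with iterates x k and preconditioners P k.
   Only x 0, ..., x K and P 0, ..., P K are constrained. A tie in the choice of
   x k.+1 may be resolved either way. *)
Definition osop_run (x0 : 'cV[R]_n) cP (eta : R) (K : nat)
    (x : nat -> 'cV[R]_n) (P : nat -> 'M[R]_n) : Prop :=
  [/\ x 0%N = x0, P 0%N = 1%:M &
   forall k, (k < K)%N ->
     [/\ x k <> split_op (x k),
         P k.+1 = proj cP (P k - eta *: grad (feedback (x k)) (P k)) &
         argmin [set x k; pstep (x k) (P k)] envelope (x k.+1)]].

End Splitting.

(* [find] returns K.+1, the size of the list, if no index qualifies. *)
Definition ident_index (R : realType) (n : nat) (B : set 'cV[R]_n) (K : nat)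
    (x : nat -> 'cV[R]_n) : nat :=
  find (fun k => `[< forall j, (k <= j <= K)%N -> B (x j) >]) (iota 0 K.+1).

(* Main.v *)
Require Import Defs.
From mathcomp Require Import ring lra.

(* Write x = p(x) + th gam grad f (p(x)), with th = 0 for FB and th = 1 for DR.
   Then F_gam(x) is the forward-backward envelope at p(x), and x - T(x) is the
   forward-backward residual at p(x), so both splittings are handled at once. With
   A = gam Hess f (p(x)), S = (I + th A)^-1 and B = (I - A) S, the gradient of F_gam
   is gam^-1 B (x - T(x)). Its increments are, to first order, those of the
   symmetric matrix B S - B J B (J a secant matrix of prox_(gam g), 0 <= J <= I) plus
   a term due to the variation of the Hessian; a subdivision of the segment then
   gives the exact constant L_gam, and G_ell bounds the gradients of the feedback.

   Projected online gradient descent has regret at most Delta G_ell sqrt K against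
   any fixed P in cP, over any time window. Against P = I, which decreases F_gam by a
   fixed multiple of the squared residual, this bounds the time spent outside the
   ball, where the residual is bounded below. Against P = (I - M)^-1, whose step
   reaches x* at once, the regret at time k controls the ratio of successive squared
   distances to x*, and the AM-GM inequality bounds the product of these ratios. *)

Set Implicit Arguments.
Unset Strict Implicit.
Unset Printing Implicit Defensive.

(** * Frobenius inner product *)

Section FrobeniusInner.
Context {R : realType}.

(** A proximal map has no derivative in general, so the envelope need not be twice differentiable
    and [L_gam] cannot be read off a Hessian. Firm nonexpansiveness replaces the missing derivative:
    it produces, for two given points, a symmetric [J] that realises the increment of the map, and
    the symmetry of [B S - B J B] lets its norm be bounded by its quadratic form, without loss in
    the constant. [S] is the derivative of [p], and [B] that of the forward step
    [p - gam grad f(p)]. In [G_ell], the term [gam^-1] bounds the gradient of the envelope at [x];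
    [L_gam (1 + Delta)] bounds its change up to the trial point, because [I] in [cP] gives
    [|P r| <= (1 + Delta) |r|]. Identification concerns the last exit from the ball, while iterates
    may enter and leave it before. A fixed point of [T] minimizes the envelope, so the local regrets
    are nonnegative, as AM-GM requires. *)

Definition fdot {m n : nat} (A B : 'M[R]_(m, n)) : R := \tr (A^T *m B).

Section Generic.
Context {m n : nat}.
Implicit Types A B C : 'M[R]_(m, n).

Lemma fdotC A B : fdot A B = fdot B A.
Proof. by rewrite /fdot -mxtrace_tr trmx_mul trmxK. Qed.

Lemma fdotDl A B C : fdot (A + B) C = fdot A C + fdot B C.
Proof. by rewrite /fdot raddfD /= mulmxDl mxtraceD. Qed.

Lemma fdotDr A B C : fdot A (B + C) = fdot A B + fdot A C.
Proof. by rewrite fdotC fdotDl !(fdotC A). Qed.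

Lemma fdotNl A B : fdot (- A) B = - fdot A B.
Proof. by rewrite /fdot raddfN /= mulNmx raddfN. Qed.

Lemma fdotNr A B : fdot A (- B) = - fdot A B.
Proof. by rewrite fdotC fdotNl fdotC. Qed.

Lemma fdotZl (a : R) A B : fdot (a *: A) B = a * fdot A B.
Proof. by rewrite /fdot linearZ /= -scalemxAl mxtraceZ. Qed.

Lemma fdotZr (a : R) A B : fdot A (a *: B) = a * fdot A B.
Proof. by rewrite fdotC fdotZl fdotC. Qed.

Lemma fdot0l A : fdot 0 A = 0.
Proof. by rewrite -(scale0r A) fdotZl mul0r. Qed.

Lemma fdot0r A : fdot A 0 = 0.
Proof. by rewrite fdotC fdot0l. Qed.

Definition fdotE := (fdotDl, fdotDr, fdotNl, fdotNr, fdotZl, fdotZr).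

Lemma fdot_sqrD A B :
  fdot (A + B) (A + B) = fdot A A + 2 * fdot A B + fdot B B.
Proof. by rewrite !fdotE (fdotC B A); ring. Qed.

Lemma fdot_sqrB A B :
  fdot (A - B) (A - B) = fdot A A - 2 * fdot A B + fdot B B.
Proof. by rewrite !fdotE (fdotC B A); ring. Qed.

Lemma fdotxx A : fdot A A = \sum_i \sum_j A i j ^+ 2.
Proof.
rewrite exchange_big /=; apply: eq_bigr => j _; rewrite mxE.
by apply: eq_bigr => i _; rewrite mxE expr2.
Qed.

Lemma fdot_ge0 A : 0 <= fdot A A.
Proof.
by rewrite fdotxx; apply: sumr_ge0 => i _; apply: sumr_ge0 => j _; exact: sqr_ge0.
Qed.

Lemma fdot_delta A i j : fdot A (delta_mx i j) = A i j.
Proof.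
rewrite /fdot /mxtrace (bigD1 j) //= mxE (bigD1 i) //= !mxE !eqxx mulr1.
rewrite big1 => [|l li]; last by rewrite !mxE (negbTE li) mulr0.
rewrite big1 ?addr0 // => k kj; rewrite mxE big1 // => l _.
by rewrite !mxE (negbTE kj) andbF mulr0.
Qed.

Lemma fnorm_sqr A : fnorm A ^+ 2 = fdot A A.
Proof. by rewrite /fnorm -fdotxx sqr_sqrtr ?fdot_ge0. Qed.

Lemma fnorm_ge0 A : 0 <= fnorm A.
Proof. exact: sqrtr_ge0. Qed.

Lemma fnorm0 : fnorm (0 : 'M[R]_(m, n)) = 0.
Proof. by apply/eqP; rewrite -sqrf_eq0 fnorm_sqr fdot0l. Qed.

Lemma entry_le_fnorm A i j : `|A i j| <= fnorm A.
Proof.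
rewrite -sqrtr_sqr ler_wsqrtr // (bigD1 i) //= (bigD1 j) //= -addrA.
rewrite lerDl addr_ge0 //; first by apply: sumr_ge0 => ? _; exact: sqr_ge0.
by apply: sumr_ge0 => ? _; apply: sumr_ge0 => ? _; exact: sqr_ge0.
Qed.

Lemma fnorm_eq0 A : fnorm A = 0 -> A = 0.
Proof.
move=> A0; apply/matrixP => i j; rewrite mxE; apply/eqP.
by rewrite -normr_le0 -A0 entry_le_fnorm.
Qed.

Lemma fnorm_gt0 A : A != 0 -> 0 < fnorm A.
Proof.
move=> A0; rewrite lt_neqAle fnorm_ge0 andbT eq_sym.
by apply: contra A0 => /eqP/fnorm_eq0 ->.
Qed.

Lemma fnormZ (a : R) A : fnorm (a *: A) = `|a| * fnorm A.
Proof.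
apply/eqP; rewrite -(@eqrXn2 _ 2) ?mulr_ge0 ?fnorm_ge0 //.
by rewrite exprMn !fnorm_sqr fdotZl fdotZr mulrA -expr2 real_normK ?num_real.
Qed.

Lemma fnormN A : fnorm (- A) = fnorm A.
Proof. by rewrite -scaleN1r fnormZ normrN1 mul1r. Qed.

Lemma fnormBC A B : fnorm (A - B) = fnorm (B - A).
Proof. by rewrite -fnormN opprB. Qed.

Lemma fdot_CS A B : fdot A B <= fnorm A * fnorm B.
Proof.
have [->|B0] := eqVneq B 0; first by rewrite fdot0r fnorm0 mulr0.
have b0 := fnorm_gt0 B0.
have [->|A0] := eqVneq A 0; first by rewrite fdot0l fnorm0 mul0r.
have a0 := fnorm_gt0 A0.
have := fdot_ge0 (fnorm B *: A - fnorm A *: B).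
rewrite !fdotE -!fnorm_sqr (fdotC B A) => h.
rewrite -(ler_pM2l (mulr_gt0 a0 b0)); nra.
Qed.

Lemma fdot_CS_abs A B : `|fdot A B| <= fnorm A * fnorm B.
Proof.
rewrite ler_norml fdot_CS andbT lerNl -fdotNl.
by rewrite (le_trans (fdot_CS _ _)) // fnormN.
Qed.

Lemma ler_fnormD A B : fnorm (A + B) <= fnorm A + fnorm B.
Proof.
rewrite -(@ler_pXn2r _ 2) ?nnegrE ?addr_ge0 ?fnorm_ge0 //.
rewrite fnorm_sqr !fdotE -!fnorm_sqr (fdotC B A).
have := fdot_CS A B; nra.
Qed.

Lemma ler_fnormB A B : fnorm (A - B) <= fnorm A + fnorm B.
Proof. by rewrite -(fnormN B) ler_fnormD. Qed.

Lemma ler_fnorm_dist A B C : fnorm (A - C) <= fnorm (A - B) + fnorm (B - C).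
Proof. by rewrite (le_trans _ (ler_fnormD _ _)) // addrA subrK. Qed.

Lemma fnorm_le_of_sqr A (c : R) : 0 <= c -> fdot A A <= c ^+ 2 -> fnorm A <= c.
Proof.
by move=> c0; rewrite -fnorm_sqr ler_pXn2r ?nnegrE ?fnorm_ge0.
Qed.

Lemma mx_norm_le_fnorm A : `|A| <= fnorm A.
Proof.
rewrite /Num.Def.normr /= mx_normrE; apply/bigmax_leP; split; first exact: fnorm_ge0.
by move=> ij _; exact: entry_le_fnorm.
Qed.

(** The factor is far from sharp. Equivalence of the two norms is all that is needed to pass between
    the topology, given by the sup norm, and Euclidean estimates. *)
Lemma fnorm_le_mx_norm A : fnorm A <= (m * n)%:R * `|A|.
Proof.
have ent i j : `|A i j| <= `|A|.
  rewrite [leRHS]/Num.Def.normr /= mx_normrE; apply/bigmax_geP; right => /=.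
  by exists (i, j).
rewrite -[leRHS]ger0_norm ?mulr_ge0 //.
rewrite -sqrtr_sqr ler_wsqrtr //.
apply: (@le_trans _ _ ((m * n)%:R * `|A| ^+ 2)); last first.
  rewrite exprMn ler_wpM2r ?sqr_ge0 // -natrX ler_nat.
  by case: (m * n)%N => // k; rewrite expnS expn1 leq_pmulr.
rewrite natrM -mulrA -[m in m%:R]card_ord -sumr_const mulr_suml.
apply: ler_sum => i _; rewrite mul1r -[n in n%:R]card_ord -sumr_const mulr_suml.
apply: ler_sum => j _; rewrite mul1r -[A i j ^+ 2]ger0_norm ?sqr_ge0 // normrX.
by rewrite ler_pXn2r ?nnegrE.
Qed.

End Generic.

Lemma fdot_mulmxl {m n p : nat} (A : 'M[R]_(m, n)) (u : 'M[R]_(n, p)) v :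
  fdot (A *m u) v = fdot u (A^T *m v).
Proof. by rewrite /fdot trmx_mul mulmxA. Qed.

Lemma fdot_outer {m n : nat} (u : 'cV[R]_m) (r : 'cV[R]_n) (P : 'M[R]_(m, n)) :
  fdot (u *m r^T) P = fdot u (P *m r).
Proof.
by rewrite /fdot trmx_mul trmxK -mulmxA mxtrace_mulC mulmxA.
Qed.

Lemma fnorm_outer {m n : nat} (u : 'cV[R]_m) (r : 'cV[R]_n) :
  fnorm (u *m r^T) = fnorm u * fnorm r.
Proof.
apply/eqP; rewrite -(@eqrXn2 _ 2) ?mulr_ge0 ?fnorm_ge0 // exprMn !fnorm_sqr.
rewrite fdot_outer -mulmxA [r^T *m r]mx11_scalar mul_mx_scalar fdotZr.
by rewrite mulrC /fdot [\tr (r^T *m r)]trace_mx11.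
Qed.

(** Cauchy-Schwarz between [A] and the rank-one matrix [A *m v *m v^T], divided by the norm of
    [A *m v]. *)
Lemma fnorm_mulmx {m n : nat} (A : 'M[R]_(m, n)) (v : 'cV[R]_n) :
  fnorm (A *m v) <= fnorm A * fnorm v.
Proof.
have [->|Av0] := eqVneq (A *m v) 0.
  by rewrite fnorm0 mulr_ge0 ?fnorm_ge0.
have := fdot_CS (A *m v *m v^T) A; rewrite fdot_outer fnorm_outer -fnorm_sqr expr2.
by rewrite -mulrA ler_pM2l ?fnorm_gt0 // mulrC.
Qed.

Lemma fdot_vecE {n : nat} (u v : 'cV[R]_n) : (u^T *m v) 0 0 = fdot u v.
Proof. by rewrite /fdot trace_mx11. Qed.

Lemma fdot_quadE {n : nat} (A : 'M[R]_n) (v : 'cV[R]_n) :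
  (v^T *m A *m v) 0 0 = fdot v (A *m v).
Proof. by rewrite -mulmxA fdot_vecE. Qed.

(* Cauchy-Schwarz for the form of A, applied to v and A v. *)
Lemma psd_mulmx_sqr {n : nat} (A : 'M[R]_n) (c : R) (v : 'cV[R]_n) :
  A^T = A -> (forall u : 'cV[R]_n, 0 <= fdot u (A *m u) <= c * fdot u u) ->
  fdot (A *m v) (A *m v) <= c * fdot v (A *m v).
Proof.
move=> Asym hA; set w := A *m v.
have hvw : fdot v (A *m w) = fdot w w by rewrite -{1}Asym -fdot_mulmxl.
have hwv : fdot w (A *m v) = fdot w w by [].
have h t : 0 <= fdot v (A *m v) - 2 * t * fdot w w + t ^+ 2 * fdot w (A *m w).
  have /andP[+ _] := hA (v - t *: w).
  rewrite mulmxBr -scalemxAr !fdotE hvw hwv; nra.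
have /andP[vAv0 _] := hA v.
have /andP[wAw0 wAw] := hA w.
have w0 := fdot_ge0 w.
have [c0|c0] := leP c 0.
  have /andP[_ vAv] := hA v; have v0 := fdot_ge0 v.
  have h1 := h 1; have cv : c * fdot v v <= 0 by rewrite mulr_le0_ge0.
  have cw : c * fdot w w <= 0 by rewrite mulr_le0_ge0.
  have vAv00 : fdot v (A *m v) = 0.
    by apply/eqP; rewrite eq_le vAv0 (le_trans vAv cv).
  by rewrite vAv00 mulr0; nra.
have := h c^-1; have ci : 0 < c^-1 by rewrite invr_gt0.
have cc : c * c^-1 = 1 by rewrite divff // gt_eqF.
have : c^-1 ^+ 2 * fdot w (A *m w) <= c^-1 * fdot w w.
  rewrite expr2 -mulrA ler_pM2l // -(ler_pM2l c0) mulrA cc mul1r //.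
move=> h1 h2.
have h3 : c^-1 * fdot w w <= fdot v (A *m v) by nra.
have := h3; rewrite -(ler_pM2l c0) mulrA cc mul1r //.
Qed.

Lemma psd_mulmx_norm {n : nat} (A : 'M[R]_n) (c : R) (v : 'cV[R]_n) :
  0 <= c -> A^T = A -> (forall u : 'cV[R]_n, 0 <= fdot u (A *m u) <= c * fdot u u) ->
  fnorm (A *m v) <= c * fnorm v.
Proof.
move=> c0 Asym hA; apply: fnorm_le_of_sqr; first by rewrite mulr_ge0 ?fnorm_ge0.
apply: le_trans (psd_mulmx_sqr v Asym hA) _.
have /andP[_ hv] := hA v; rewrite exprMn expr2 -mulrA ler_wpM2l //.
by rewrite fnorm_sqr.
Qed.

Lemma fnorm_le_opnorm {n : nat} (A : 'M[R]_n) (v : 'cV[R]_n) :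
  fnorm v <= 1 -> fnorm (A *m v) <= opnorm A.
Proof.
move=> v1; apply: ub_le_sup; last by exists v.
exists (fnorm A) => _ [u /= u1 <-].
by rewrite (le_trans (fnorm_mulmx _ _)) // ler_piMr // fnorm_ge0.
Qed.

Lemma opnorm_ge0 {n : nat} (A : 'M[R]_n) : 0 <= opnorm A.
Proof.
have : fnorm (0 : 'cV[R]_n) <= 1 by rewrite fnorm0.
by move/(fnorm_le_opnorm A); apply: le_trans; exact: fnorm_ge0.
Qed.

Lemma opnorm_mulmx {n : nat} (A : 'M[R]_n) (v : 'cV[R]_n) :
  fnorm (A *m v) <= opnorm A * fnorm v.
Proof.
have [->|v0] := eqVneq v 0; first by rewrite mulmx0 fnorm0 mulr0.
have nv := fnorm_gt0 v0; rewrite -ler_pdivrMr //.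
have -> : fnorm (A *m v) / fnorm v = fnorm (A *m ((fnorm v)^-1 *: v)).
  by rewrite -scalemxAr fnormZ ger0_norm ?invr_ge0 ?fnorm_ge0 // mulrC.
apply: fnorm_le_opnorm.
by rewrite fnormZ ger0_norm ?invr_ge0 ?fnorm_ge0 // mulVf // gt_eqF.
Qed.

End FrobeniusInner.

(* Turning inner products and norms into variables identifies the convertible ones,
   which lra alone does not. *)
Ltac dot_lra :=
  repeat match goal with
  | |- context [@fdot ?R ?m ?n ?A ?B] => move: (@fdot R m n A B)
  | |- context [@fnorm ?R ?m ?n ?A] => move: (@fnorm R m n A)
  end;
  repeat (let a := fresh "atom" in intro a); lra.

(** * Convexity with real weights, and convex hulls *)

Section ConvexReal.
Context {R : realType}.

Lemma convex_functionP {V : lmodType R} (A : set V) (h : V -> R) :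
  @convex_function R V A h <->
  forall x y t, A x -> A y -> 0 <= t <= 1 ->
    h (t *: x + (1 - t) *: y) <= t * h x + (1 - t) * h y.
Proof.
split=> [hc x y t Ax Ay /andP[t0 t1]|hc t x y /set_mem Ax /set_mem Ay].
  by have := hc (Itv01 t0 t1) x y (mem_set Ax) (mem_set Ay).
by apply: hc => //; rewrite ge0 le1.
Qed.

Lemma convex_setP {V : lmodType R} (A : set V) :
  @convex_set R V A <->
  forall x y t, A x -> A y -> 0 <= t <= 1 -> A (t *: x + (1 - t) *: y).
Proof.
split=> [hc x y t Ax Ay /andP[t0 t1]|hc x y t /set_mem Ax /set_mem Ay].
  by have /set_mem := hc x y (Itv01 t0 t1) (mem_set Ax) (mem_set Ay).
by apply/mem_set; apply: hc => //; rewrite ge0 le1.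
Qed.

Lemma convex_hull_sub {n : nat} (A : set 'cV[R]_n) : A `<=` convex_hull A.
Proof. exact: sub_gen_smallest. Qed.

Lemma convex_hull_convex {n : nat} (A : set 'cV[R]_n) :
  @convex_set R 'cV[R]_n (convex_hull A).
Proof.
apply/convex_setP => x y t hx hy t01 B [/= Bc AB].
by move/convex_setP : (Bc); apply => //; [exact: hx|exact: hy].
Qed.

End ConvexReal.

(** * First-order expansions *)

Section Expansions.
Context {R : realType}.

Implicit Types e d t : R.

Lemma diff_expansion {V W : normedModType R} (F : V -> W) (x : V) :
  differentiable F x -> forall e : R, 0 < e ->
  exists2 d, 0 < d & forall v, `|v| <= d ->
    `|F (x + v) - F x - 'd F x v| <= e * `|v|.
Proof.
move=> dF e e0; have /eqaddoP := diff_locally dF.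
move=> /(_ e e0) /nbhs_ballP[r /= r0 hr].
exists (r / 2); first by rewrite divr_gt0.
move=> v vr; have := hr v; rewrite /= -ball_normE /= sub0r normrN.
rewrite -[F (x + v) - F x - 'd F x v]addrA -opprD [x + v]addrC; apply.
by rewrite (le_lt_trans vr) // ltr_pdivrMr // ltr_pMr // ltr1n.
Qed.

(** Differentiability with a prescribed gradient, in the Euclidean norm. The Moreau and
    forward-backward envelopes come with first-order estimates and an explicit candidate;
    [has_grad_gradE] identifies it with [grad] afterwards. *)
Definition has_grad {n : nat} (h : 'cV[R]_n -> R) (x G : 'cV[R]_n) :=
  forall e, 0 < e -> exists2 d, 0 < d & forall v, fnorm v <= d ->
    `|h (x + v) - h x - fdot G v| <= e * fnorm v.

Definition has_jac {n : nat} (F : 'cV[R]_n -> 'cV[R]_n) (x : 'cV[R]_n) (J : 'M[R]_n) :=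
  forall e, 0 < e -> exists2 d, 0 < d & forall v, fnorm v <= d ->
    fnorm (F (x + v) - F x - J *m v) <= e * fnorm v.

Lemma diff_grad {n : nat} (h : 'cV[R]_n -> R) (x v : 'cV[R]_n) :
  differentiable h x -> 'd h x v = fdot (grad h x) v.
Proof.
move=> dh; rewrite {1}[v]matrix_sum_delta linear_sum /fdot /mxtrace.
rewrite big_ord1 mxE; apply: eq_bigr => i _.
by rewrite big_ord1 linearZ /= -deriveE // !mxE mulrC.
Qed.

Lemma differentiable_has_grad {n : nat} (h : 'cV[R]_n -> R) (x : 'cV[R]_n) :
  differentiable h x -> has_grad h x (grad h x).
Proof.
move=> dh e e0; have [d d0 hd] := diff_expansion dh e0.
exists d => // v vd; rewrite -diff_grad //.
have vv := mx_norm_le_fnorm v.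
by rewrite (le_trans (hd v (le_trans vv vd))) // ler_wpM2l // ltW.
Qed.

Lemma diff_hess {n : nat} (h : 'cV[R]_n -> R) (x v : 'cV[R]_n) :
  differentiable (grad h) x -> 'd (grad h) x v = hess h x *m v.
Proof.
move=> dh; rewrite {1}[v]matrix_sum_delta linear_sum; apply/colP => i.
rewrite summxE mxE; apply: eq_bigr => j _.
rewrite big_ord1 linearZ /= mxE -deriveE // derive_mx; last exact: diff_derivable.
by rewrite !mxE mulrC.
Qed.

Lemma differentiable_has_jac {n : nat} (h : 'cV[R]_n -> R) (x : 'cV[R]_n) :
  differentiable (grad h) x -> has_jac (grad h) x (hess h x).
Proof.
move=> dh e e0; pose k : R := (n * 1)%:R + 1.
have k0 : 0 < k by rewrite ltr_wpDl.
have [d d0 hd] := diff_expansion dh (divr_gt0 e0 k0).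
exists d => // v vd; rewrite -diff_hess //.
have vv := mx_norm_le_fnorm v.
apply: le_trans (fnorm_le_mx_norm _) _.
apply: (@le_trans _ _ (k * (e / k * `|v|))); last first.
  by rewrite mulrA mulrCA divff ?gt_eqF // mulr1 ler_wpM2l // ltW.
apply: ler_pM => //; first by rewrite lerDl.
exact: hd (le_trans vv vd).
Qed.

Lemma is_derive_expansion {V : normedModType R} (h : V -> R) (a v : V) (c : R) :
  (forall e, 0 < e -> exists2 d, 0 < d & forall t : R, `|t| <= d ->
     `|h (a + t *: v) - h a - t * c| <= e * `|t|) ->
  is_derive a v h c.
Proof.
move=> hh.
have hc : (fun t : R => t^-1 *: ((h \o shift a) (t *: v) - h a)) @ 0^' --> c.
  apply/cvgrPdist_le => e e0; have [d d0 hd] := hh e e0.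
  near=> t.
  have t0 : t != 0 by near: t; exact: nbhs_dnbhs_neq.
  have td : `|t| <= d by near: t; exact: dnbhs0_le.
  have := hd t td; rewrite /= [t *: v + a]addrC => htd.
  rewrite distrC -(ler_pM2l (_ : 0 < `|t|)) ?normr_gt0 // -normrM mulrBr.
  by rewrite /GRing.scale /= mulrA divff // mul1r [leRHS]mulrC.
split; first by apply/cvg_ex; exists c.
exact: cvg_lim hc.
Unshelve. all: by end_near. Qed.

Lemma has_grad_along {n : nat} (h : 'cV[R]_n -> R) (x d G : 'cV[R]_n) e :
  has_grad h x G -> 0 < e -> exists2 r, 0 < r & forall s, `|s| <= r ->
    `|h (x + s *: d) - h x - s * fdot G d| <= e * `|s|.
Proof.
move=> hG e0; have k0 : 0 < fnorm d + 1 by rewrite ltr_wpDl ?fnorm_ge0.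
have [r r0 hr] := hG _ (divr_gt0 e0 k0).
exists (r / (fnorm d + 1)); first exact: divr_gt0.
move=> s sr; have sd : fnorm (s *: d) <= `|s| * (fnorm d + 1).
  by rewrite fnormZ ler_wpM2l // lerDl.
rewrite -fdotZr; apply: le_trans (hr _ _) _.
  by apply: le_trans sd _; rewrite -ler_pdivlMr.
apply: le_trans (ler_wpM2l (ltW (divr_gt0 e0 k0)) sd) _.
by rewrite mulrCA divfK ?gt_eqF // mulrC.
Qed.

Lemma has_grad_is_derive {n : nat} (h : 'cV[R]_n -> R) (x d G : 'cV[R]_n) :
  has_grad h x G -> is_derive x d h (fdot G d).
Proof. by move=> hG; apply: is_derive_expansion => e; exact: has_grad_along. Qed.

Lemma has_grad_gradE {n : nat} (h : 'cV[R]_n -> R) (x G : 'cV[R]_n) :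
  has_grad h x G -> grad h x = G.
Proof.
move=> hG; apply/colP => i; rewrite mxE.
rewrite (@derive_val _ _ _ _ _ _ _ (has_grad_is_derive (delta_mx i 0) hG)).
exact: fdot_delta.
Qed.

Lemma has_grad_derive_line {n : nat} (h : 'cV[R]_n -> R) (x d : 'cV[R]_n) (t : R) G :
  has_grad h (x + t *: d) G ->
  is_derive t (1 : R) (fun s : R => h (x + s *: d)) (fdot G d).
Proof.
move=> hG; apply: is_derive_expansion => e e0.
have [r r0 hr] := has_grad_along d hG e0; exists r => // s /hr.
by rewrite (_ : s *: (1 : R) = s) ?scalerDl ?addrA //; exact: mulr1.
Qed.

Lemma quadratic_has_grad {n : nat} (h : 'cV[R]_n -> R) (x G : 'cV[R]_n) (c : R) :
  (forall y : 'cV[R]_n,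
     `|h y - h x - fdot G (y - x)| <= c * fdot (y - x) (y - x)) ->
  has_grad h x G.
Proof.
move=> hq e e0; have c0 : 0 < `|c| + 1 by rewrite ltr_wpDl.
exists (e / (`|c| + 1)) => [|v]; first exact: divr_gt0.
rewrite ler_pdivlMr // => hv.
have := hq (x + v); rewrite [x + v - x]addrAC subrr add0r => /le_trans; apply.
rewrite -fnorm_sqr expr2 mulrA ler_wpM2r ?fnorm_ge0 //.
apply: le_trans hv; rewrite mulrC ler_wpM2l ?fnorm_ge0 //.
by rewrite (le_trans (ler_norm c)) // lerDl.
Qed.

(** Used in place of integration: an estimate along a segment becomes a bound on the derivative of
    one scalar function on the unit interval. *)
Lemma mean_value_le (phi dphi : R -> R) (c : R) :
  (forall t : R, 0 <= t <= 1 -> is_derive t (1 : R) phi (dphi t)) ->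
  (forall t : R, 0 <= t <= 1 -> dphi t <= c) -> phi 1 - phi 0 <= c.
Proof.
move=> hphi hc.
have [t t01 ->] : exists2 t, t \in `[0, 1]%R & phi 1 - phi 0 = dphi t * (1 - 0).
  apply: MVT_segment => //.
    move=> t; rewrite in_itv /= => /andP[t0 t1]; apply: hphi.
    by rewrite !ltW.
  apply: derivable_within_continuous => t; rewrite in_itv /= => t01.
  exact: (@ex_derive _ _ _ _ _ _ _ (hphi t t01)).
by rewrite subr0 mulr1; apply: hc; move: t01; rewrite in_itv.
Qed.

(** By convexity the slope from [x] towards [y] over a short step [t] is at most [h y - h x], and it
    differs from [fdot G (y - x)] by at most [e]. *)
Lemma convex_has_grad {n : nat} (h : 'cV[R]_n -> R) (x y G : 'cV[R]_n) :
  @convex_function R 'cV[R]_n setT h -> has_grad h x G ->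
  h x + fdot G (y - x) <= h y.
Proof.
move=> /convex_functionP hc hG; set d := y - x.
have k0 : 0 < fnorm d + 1 by rewrite ltr_wpDl ?fnorm_ge0.
apply/ler_addgt0Pr => e e0.
have [r r0 hr] := hG _ (divr_gt0 e0 k0).
pose t := Num.min 1 (r / (fnorm d + 1)).
have t0 : 0 < t by rewrite lt_min ltr01 divr_gt0.
have t1 : t <= 1 by rewrite ge_min lexx.
have td : t * fnorm d <= r.
  apply: (@le_trans _ _ (t * (fnorm d + 1))).
    by rewrite ler_pM2l // lerDl.
  by rewrite -ler_pdivlMr // ge_min lexx orbT.
have := hc y x t I I; rewrite (ltW t0) t1 => /(_ isT).
have -> : t *: y + (1 - t) *: x = x + t *: d.
  by rewrite /d scalerBr scalerBl scale1r addrCA.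
have := hr (t *: d); rewrite fnormZ ger0_norm ?(ltW t0) // => /(_ td).
rewrite fdotZr ler_norml => /andP[h1 _] h2.
have h3 : e / (fnorm d + 1) * (t * fnorm d) <= t * e.
  rewrite [leLHS]mulrCA ler_pM2l // -mulrA ler_piMr ?(ltW e0) //.
  by rewrite mulrC ler_pdivrMr // mul1r lerDl.
rewrite -(ler_pM2l t0); lra.
Qed.

End Expansions.

(** * Smooth convex functions *)

Section SmoothConvex.
Opaque grad hess fdot fnorm.
Context {R : realType}.

Lemma is_derive_quad (a b t : R) :
  is_derive t (1 : R) (fun s : R => s * a + b * s ^+ 2) (a + 2 * b * t).
Proof.
apply: is_derive_expansion => e e0; exists (e / (`|b| + 1)).
  by rewrite divr_gt0 // ltr_wpDl.
move=> s sd; rewrite (_ : s *: (1 : R) = s); last exact: mulr1.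
have -> : (t + s) * a + b * (t + s) ^+ 2 - (t * a + b * t ^+ 2)
          - s * (a + 2 * b * t) = b * s * s by ring.
rewrite normrM ler_wpM2r // normrM.
apply: (@le_trans _ _ ((`|b| + 1) * `|s|)); first by rewrite ler_wpM2r // lerDl.
by rewrite mulrC -ler_pdivlMr // ltr_wpDl.
Qed.

Lemma has_jac_fdot {n : nat} (F : 'cV[R]_n -> 'cV[R]_n) (x : 'cV[R]_n) J (w : 'cV[R]_n) :
  has_jac F x J -> has_grad (fun y => fdot (F y) w) x (J^T *m w).
Proof.
move=> hJ e e0; have k0 : 0 < fnorm w + 1 by rewrite ltr_wpDl ?fnorm_ge0.
have [d d0 hd] := hJ _ (divr_gt0 e0 k0); exists d => // v vd.
have -> : fdot (F (x + v)) w - fdot (F x) w - fdot (J^T *m w) v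
          = fdot (F (x + v) - F x - J *m v) w.
  by rewrite !fdotE fdot_mulmxl trmxK (fdotC w).
apply: le_trans (fdot_CS_abs _ _) _.
apply: le_trans (ler_wpM2r (fnorm_ge0 _) (hd v vd)) _.
rewrite mulrAC ler_wpM2r ?fnorm_ge0 // -mulrA ler_piMr ?(ltW e0) //.
by rewrite mulrC ler_pdivrMr // mul1r lerDl.
Qed.

Context {n : nat} (f : 'cV[R]_n -> R) (L : R).
Hypothesis L0 : 0 < L.
Hypothesis fsmooth : smooth L f.
Hypothesis fconvex : @convex_function R 'cV[R]_n setT f.
Local Notation df := (grad f).
Implicit Types x y z v w d : 'cV[R]_n.
Implicit Types t e : R.

Lemma smooth_has_grad x : has_grad f x (df x).
Proof. by apply: differentiable_has_grad; exact: fsmooth.1. Qed.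

Lemma convex_grad_le x y : f x + fdot (df x) (y - x) <= f y.
Proof. exact: convex_has_grad (smooth_has_grad x). Qed.

Lemma descent_lemma x y :
  f y <= f x + fdot (df x) (y - x) + L / 2 * fdot (y - x) (y - x).
Proof.
set d := y - x.
have xd : x + d = y by rewrite addrC subrK.
(* Up to a constant, [phi] is [f] minus the claimed upper bound along the segment; the Lipschitz
   gradient makes its derivative nonpositive. *)
pose phi s := f (x + s *: d)
  + (s * (- fdot (df x) d) + (- (L / 2 * fdot d d)) * s ^+ 2).
have : phi 1 - phi 0 <= 0.
  apply: (@mean_value_le _ phi (fun s => fdot (df (x + s *: d)) d
           + (- fdot (df x) d + 2 * (- (L / 2 * fdot d d)) * s))).
    move=> t _; apply: is_deriveD; last exact: is_derive_quad.
    exact/has_grad_derive_line/smooth_has_grad.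
  move=> t /andP[t0 _].
  have := fdot_CS (df (x + t *: d) - df x) d.
  have := fsmooth.2 (x + t *: d) x; rewrite [x + _]addrC addrK fnormZ ger0_norm //.
  rewrite fdotDl fdotNl -fnorm_sqr => h1 h2.
  by move: h2 (ler_wpM2r (fnorm_ge0 d) h1); dot_lra.
rewrite /phi scale1r scale0r addr0 xd; dot_lra.
Qed.

Lemma bregman_lower x y :
  f x + fdot (df x) (y - x)
    + (2 * L)^-1 * fdot (df y - df x) (df y - df x) <= f y.
Proof.
have [D DE] : exists D, D = df y - df x by eexists.
(* [z] is the gradient step from [y] for [f] minus its linear part at [x]. There [f] is bounded
   below by its tangent at [x] and above by the descent lemma at [y]. *)
rewrite -DE; pose z := y - L^-1 *: D.
have h1 := convex_grad_le x z; have h2 := descent_lemma y z.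
have zy : z - y = - (L^-1 *: D) by rewrite /z addrC addKr.
have zx : z - x = (y - x) - L^-1 *: D by rewrite /z addrAC.
move: h1 h2; rewrite zy zx !fdotE.
have -> : fdot D D = fdot (df y) D - fdot (df x) D by rewrite {1}DE !fdotE.
have LL : L * L^-1 = 1 by rewrite divff // gt_eqF.
have -> : (2 * L)^-1 = 2^-1 * L^-1 by rewrite invfM.
move: (fdot (df y) D) (fdot (df x) D) (L^-1) LL => a b i LL.
have -> : L / 2 * - - (i * (i * (a - b))) = (L * i) * i * (a - b) / 2 by ring.
rewrite LL; move: (f z); dot_lra.
Qed.

Lemma cocoercive x y :
  L^-1 * fdot (df y - df x) (df y - df x) <= fdot (df y - df x) (y - x).
Proof.
move: (bregman_lower x y) (bregman_lower y x).
move: (f x) (f y) (df x) (df y) => a b gx gy.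
rewrite -(opprB y x) -(opprB gy gx) !fdotNl !fdotNr opprK invfM.
rewrite [fdot (gy - gx) (y - x)]fdotDl fdotNl.
by move: (L^-1); dot_lra.
Qed.

Lemma grad_monotone x y : 0 <= fdot (df y - df x) (y - x).
Proof.
apply: le_trans (cocoercive x y).
by rewrite mulr_ge0 ?invr_ge0 ?(ltW L0) // fdot_ge0.
Qed.

Section Hessian.
Hypothesis f2 : forall x, differentiable (grad f) x.
Variable Of : set 'cV[R]_n.
Hypothesis Of_convex : @convex_set R 'cV[R]_n Of.

Lemma segment_mem x y (t : R) :
  Of x -> Of y -> 0 <= t <= 1 -> Of (x + t *: (y - x)).
Proof.
move=> Ox Oy t01; have /convex_setP/(_ y x t Oy Ox t01) := Of_convex.
by rewrite scalerBr scalerBl scale1r addrCA.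
Qed.

Lemma grad_derive_line x d w (t : R) :
  is_derive t (1 : R) (fun s : R => fdot (df (x + s *: d)) w)
    (fdot (hess f (x + t *: d) *m d) w).
Proof.
have -> : fdot (hess f (x + t *: d) *m d) w = fdot ((hess f (x + t *: d))^T *m w) d.
  by rewrite [RHS]fdot_mulmxl trmxK fdotC.
apply: (@has_grad_derive_line _ _ (fun z => fdot (df z) w)).
by apply: has_jac_fdot; exact: differentiable_has_jac.
Qed.

(** The remainder [w] is paired with itself, which reduces the estimate to a scalar one. The factor
    [H] instead of [H / 2] is harmless: this error is of second order and disappears under
    subdivision. *)
Lemma grad_taylor (H : R) x y : 0 <= H ->
  (forall a b (v : 'cV[R]_n), Of a -> Of b ->
     fnorm ((hess f a - hess f b) *m v) <= H * fnorm (a - b) * fnorm v) ->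
  Of x -> Of y ->
  fnorm (df y - df x - hess f x *m (y - x)) <= H * fnorm (y - x) ^+ 2.
Proof.
move=> H0 hH Ox Oy; set d := y - x; set w := _ - _ - _.
have xd : x + d = y by rewrite addrC subrK.
have [->|w0] := eqVneq w 0; first by rewrite fnorm0 mulr_ge0 ?sqr_ge0.
have nw := fnorm_gt0 w0.
have h := @mean_value_le R (fun s : R => fdot (df (x + s *: d)) w) _
  (fdot (hess f x *m d) w + H * fnorm d ^+ 2 * fnorm w)
  (fun t _ => grad_derive_line x d w t).
have /h : forall t : R, 0 <= t <= 1 -> fdot (hess f (x + t *: d) *m d) w <=
    fdot (hess f x *m d) w + H * fnorm d ^+ 2 * fnorm w.
  move=> t t01; rewrite -lerBlDl -fdotNl -fdotDl -mulmxBl.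
  apply: le_trans (fdot_CS _ _) _; rewrite ler_wpM2r ?fnorm_ge0 //.
  apply: le_trans (hH _ _ _ (segment_mem Ox Oy t01) Ox) _.
  rewrite expr2 mulrA ler_wpM2r ?fnorm_ge0 // ler_wpM2l // [x + _]addrC addrK.
  by case/andP: t01 => t0 t1; rewrite fnormZ ger0_norm // ler_piMl ?fnorm_ge0.
rewrite scale1r scale0r addr0 xd -lerBlDl.
rewrite -!fdotNl -!fdotDl -/w -fnorm_sqr expr2.
by rewrite ler_pM2r.
Qed.

Lemma grad_strong_monotone (mu : R) x y :
  (forall a (v : 'cV[R]_n), Of a -> mu * fdot v v <= fdot v (hess f a *m v)) ->
  Of x -> Of y -> mu * fdot (y - x) (y - x) <= fdot (df y - df x) (y - x).
Proof.
move=> hmu Ox Oy; set d := y - x.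
have xd : x + d = y by rewrite addrC subrK.
have h := @mean_value_le R (fun s : R => fdot (df (x + s *: d)) (- d)) _
  (- (mu * fdot d d)) (fun t _ => grad_derive_line x d (- d) t).
have /h : forall t : R, 0 <= t <= 1 -> fdot (hess f (x + t *: d) *m d) (- d) <=
    - (mu * fdot d d).
  move=> t t01; rewrite fdotNr lerN2 fdotC; apply: hmu.
  exact: (segment_mem Ox Oy t01).
rewrite scale1r scale0r addr0 xd !fdotNr fdotDl fdotNl; dot_lra.
Qed.

End Hessian.

End SmoothConvex.

(** * Proximal maps and Moreau envelopes *)

Section Proximal.
Opaque grad hess fdot fnorm.
Context {R : realType} {n : nat}.
Implicit Types x y z v w d q : 'cV[R]_n.
Implicit Types e t G : R.

Lemma fnorm_cauchy_cvg (u : nat -> 'cV[R]_n) :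
  (forall e, 0 < e -> exists N, forall j k, (N <= j)%N -> (N <= k)%N ->
     fnorm (u j - u k) <= e) ->
  exists x : 'cV[R]_n, forall e, 0 < e -> exists N, forall k, (N <= k)%N ->
     fnorm (u k - x) <= e.
Proof.
move=> hu.
have cu : cauchy (u @ \oo).
  apply: cauchy_exP => e e0.
  have [N hN] := hu (e / 2) (divr_gt0 e0 (ltr0Sn _ 1)).
  exists (u N); exists N => // k /= Nk; rewrite -ball_normE /=.
  apply: le_lt_trans (mx_norm_le_fnorm _) _.
  apply: le_lt_trans (hN _ _ (leqnn N) Nk) _.
  by rewrite ltr_pdivrMr // ltr_pMr // ltr1n.
have hc : u @ \oo --> lim (u @ \oo) by apply: cauchy_cvg.
exists (lim (u @ \oo)) => e e0.
pose c : R := (n * 1)%:R + 1.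
have c0 : 0 < c by rewrite ltr_wpDl.
have /cvgrPdist_le/(_ _ (divr_gt0 e0 c0))[N _ hN] := hc.
exists N => k Nk; apply: le_trans (fnorm_le_mx_norm _) _.
have := hN k Nk; rewrite distrC ler_pdivlMr // mulrC => /(le_trans _); apply.
by rewrite ler_wpM2r // lerDl.
Qed.

(** Lets [t] tend to 0 in an optimality or convexity inequality along a segment, once it has been
    divided by [t]. *)
Lemma le_of_small (a b c : R) :
  (forall t, 0 < t <= 1 -> a <= b + t * c) -> a <= b.
Proof.
move=> h; apply/ler_addgt0Pr => e e0.
have c0 : 0 < `|c| + 1 by rewrite ltr_wpDl.
pose t := Num.min 1 (e / (`|c| + 1)).
have t0 : 0 < t by rewrite lt_min ltr01 divr_gt0.
have t1 : t <= 1 by rewrite ge_min lexx.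
have te : t * (`|c| + 1) <= e by rewrite -ler_pdivlMr // ge_min lexx orbT.
have := h t; rewrite t0 t1 => /(_ isT) /le_trans; apply; rewrite lerD2l.
apply: le_trans te; rewrite ler_pM2l // (le_trans (ler_norm c)) // lerDl //.
Qed.

Lemma continuous_lower_semicontinuous (f : 'cV[R]_n -> R) :
  continuous f -> lower_semicontinuous (EFin \o f).
Proof.
move=> fc x a; rewrite lte_fin => afx.
exists [set y | a < f y]; last by move=> y /=; rewrite lte_fin.
exact: cvgr_gt (fc x) _ afx.
Qed.

Variables (gam : R) (h : 'cV[R]_n -> \bar R).
Hypothesis gam0 : 0 < gam.
Hypothesis hproper : eproper h.
Hypothesis hlsc : lower_semicontinuous h.
Hypothesis hconvex : econvex h.

Local Notation dom := [set x | h x \is a fin_num].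
Local Notation hr x := (fine (h x)).
Local Notation Q z x := ((2 * gam)^-1 * fdot (x - z) (x - z)).
Local Notation i2 := ((2 * gam)^-1).

Let i20 : 0 < i2. Proof. by rewrite invr_gt0 mulr_gt0. Qed.

Let hfin x : h x \is a fin_num -> h x = (hr x)%:E.
Proof. by move=> hx; rewrite fineK. Qed.

Let not_dom x : ~ dom x -> h x = +oo%E.
Proof.
by have := hproper.1 x; rewrite /=; case: (h x) => //= r _ /(_ isT).
Qed.

Lemma econvex_fine x y t : dom x -> dom y -> 0 <= t <= 1 ->
  dom (t *: x + (1 - t) *: y) /\
  hr (t *: x + (1 - t) *: y) <= t * hr x + (1 - t) * hr y.
Proof.
move=> dx dy t01; have := hconvex x y t01.
rewrite (hfin dx) (hfin dy).
have := hproper.1 (t *: x + (1 - t) *: y).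
rewrite -!EFinM -EFinD /=; case: (h _) => //= r _.
Qed.

Lemma econvex_fine_seg x d t : dom x -> dom (x + d) -> 0 <= t <= 1 ->
  dom (x + t *: d) /\ hr (x + t *: d) <= (1 - t) * hr x + t * hr (x + d).
Proof.
move=> dx dy t01; have [] := econvex_fine dy dx t01.
rewrite scalerDr scalerBl scale1r addrAC [t *: x + _]addrC subrK.
by rewrite [t * _ + _]addrC.
Qed.

(** A minorant that decreases linearly with the distance is enough for coercivity of the proximal
    objective, so no affine minorant and no separation theorem are invoked. Lower semicontinuity
    bounds [h] below near [x1]; convexity carries the bound outwards from the point at distance
    [r / 2] on the segment to [x]. *)
Lemma econvex_lower_bound :
  exists (x1 : 'cV[R]_n) (a b : R), dom x1 /\
    forall x, dom x -> a - b * fnorm (x - x1) <= hr x.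
Proof.
have [x1 hx1] := hproper.2.
have dx1 : dom x1 by apply/fin_numP; split; [exact: hproper.1|exact: hx1].
have /hlsc [V /nbhs_ballP[r /= r0 rV] hV] : ((hr x1 - 1)%:E < h x1)%E.
  by rewrite (hfin dx1) lte_fin ltrBlDr ltrDl.
exists x1, (hr x1 - 1), (2 / r); split=> // x dx.
set d := fnorm (x - x1).
have d0 : 0 <= d := fnorm_ge0 _.
have loc y : fnorm (y - x1) < r -> dom y -> hr x1 - 1 < hr y.
  move=> yr dy; rewrite -lte_fin -(hfin dy); apply/hV/rV.
  rewrite -ball_normE /= distrC; exact: le_lt_trans (mx_norm_le_fnorm _) yr.
have r2 : 0 < r / 2 by rewrite divr_gt0.
have [dr|rd] := ltP d r.
  apply: le_trans (ltW (loc x dr dx)).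
  by rewrite gerBl mulr_ge0 // divr_ge0 // ltW.
have dpos : 0 < d := lt_le_trans r0 rd.
pose t := r / 2 / d.
have t0 : 0 < t by rewrite divr_gt0.
have td : t * d = r / 2 by rewrite /t divfK // gt_eqF.
have t1 : t <= 1 by rewrite ler_pdivrMr // mul1r; lra.
have dxx : dom (x1 + (x - x1)) by rewrite addrC subrK.
have [|dy hy] := @econvex_fine_seg x1 (x - x1) t dx1 dxx; first by rewrite (ltW t0).
have := loc (x1 + t *: (x - x1)) _ dy.
rewrite [x1 + _ - x1]addrAC subrr add0r fnormZ ger0_norm ?(ltW t0) // -/d td.
move=> /(_ _)/lt_le_trans/(_ hy); rewrite [x1 + (x - x1)]addrC subrK => hlt.
have {}hlt := hlt (_ : _ < _); have {hlt} : t * hr x1 - 1 < t * hr x.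
  have := hlt; rewrite ltr_pdivrMr // ltr_pMr // ltr1n => /(_ isT); lra.
move=> hlt; have : t * (hr x1 - 2 / r * d - hr x) <= 0.
  have -> : t * (hr x1 - 2 / r * d - hr x) = t * hr x1 - (t * d) * (2 / r) - t * hr x by ring.
  rewrite td; have -> : r / 2 * (2 / r) = 1 by field; rewrite gt_eqF.
  lra.
rewrite pmulr_rle0 //; lra.
Qed.

(** Strong convexity of the quadratic term makes a minimizing sequence Cauchy, and lower
    semicontinuity identifies its limit as a minimizer; compactness is not invoked. *)
Lemma prox_exists z : exists q, dom q /\
  forall w, dom w -> hr q + Q z q <= hr w + Q z w.
Proof.
have [x1 [a [b [dx1 hlow]]]] := econvex_lower_bound.
pose S := [set s | exists2 x, dom x & s = hr x + Q z x].
have Sinf : has_inf S.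
  split; first by exists (hr x1 + Q z x1), x1.
  exists (a - `|b| * fnorm (z - x1) - gam * `|b| ^+ 2) => _ [x dx ->].
  apply: le_trans (lerD (hlow x dx) (lexx _)).
  have h1 : fnorm (x - x1) <= fnorm (x - z) + fnorm (z - x1) by exact: ler_fnorm_dist.
  rewrite -fnorm_sqr; set t := fnorm (x - z) in h1 *.
  have h2 : b * fnorm (x - x1) <= `|b| * (t + fnorm (z - x1)).
    apply: le_trans (ler_wpM2r (fnorm_ge0 _) (ler_norm b)) _.
    by rewrite ler_wpM2l.
  (* Young's inequality: the quadratic term absorbs the linear decrease of the minorant. *)
  have h3 : `|b| * t <= gam * `|b| ^+ 2 + i2 * t ^+ 2.
    have ig : gam * gam^-1 = 1 by rewrite divff // gt_eqF.
    have : 0 <= gam * (gam^-1 * t - `|b|) ^+ 2 by rewrite mulr_ge0 ?sqr_ge0 // ltW.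
    have -> : gam * (gam^-1 * t - `|b|) ^+ 2 =
      (gam * gam^-1) * gam^-1 * t ^+ 2 - 2 * (gam * gam^-1) * t * `|b|
      + gam * `|b| ^+ 2 by ring.
    rewrite ig invfM.
    have : 0 <= gam * `|b| ^+ 2 by rewrite mulr_ge0 ?sqr_ge0 // ltW.
    lra.
  lra.
pose m := inf S.
have mle w : dom w -> m <= hr w + Q z w.
  by move=> dw; apply: ge_inf; [exact: Sinf.2|exists w].
have near_min (k : nat) : exists x, dom x /\ hr x + Q z x < m + k.+1%:R^-1.
  have k0 : 0 < k.+1%:R^-1 :> R by rewrite invr_gt0.
  by have [_ [x dx ->] hx] := inf_adherent k0 Sinf; exists x.
have [u hu] := choice near_min.
have small e : 0 < e -> exists N, forall k, (N <= k)%N -> k.+1%:R^-1 <= e :> R.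
  move=> e0; exists (Num.bound e^-1) => k Nk.
  rewrite invf_ple ?posrE //.
  have := archi_boundP (ltW (_ : 0 < e^-1)); rewrite invr_gt0 => /(_ e0) /ltW.
  by move/le_trans; apply; rewrite ler_nat ltnW.
(* Parallelogram identity at the midpoint of [u j] and [u k], where the objective is still at least
   [m]. *)
have mid j k : i2 / 4 * fdot (u j - u k) (u j - u k)
    <= (j.+1%:R^-1 + k.+1%:R^-1) / 2.
  have [dj hj] := hu j; have [dk hk] := hu k.
  have [|dm hm] := @econvex_fine (u j) (u k) 2^-1 dj dk; first lra.
  have := mle _ dm.
  have -> : 2^-1 *: u j + (1 - 2^-1) *: u k - z =
      2^-1 *: (u j - z) + (1 - 2^-1) *: (u k - z).
    by rewrite !scalerBr addrACA -opprD -scalerDl addrCA subrr addr0 scale1r.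
  have -> : u j - u k = (u j - z) - (u k - z) by rewrite opprB addrA subrK.
  move: hj hk hm; move: (u j - z) (u k - z) => a' b'.
  rewrite !fdotE (fdotC b' a').
  move: (fdot a' a') (fdot a' b') (fdot b' b') (hr (_ + _)) => aa ab bb hmid.
  move: i2 (j.+1%:R^-1) (k.+1%:R^-1) => i ej ek h1 h2 h3 h4; lra.
have [|x hx] := @fnorm_cauchy_cvg u.
  move=> e e0.
  have c0 : 0 < i2 / 4 * e ^+ 2 by rewrite mulr_gt0 ?divr_gt0 // exprn_gt0.
  have [N hN] := small _ c0; exists N => j k Nj Nk.
  apply: fnorm_le_of_sqr; first exact: ltW.
  have := mid j k; have := hN j Nj; have := hN k Nk => h1 h2 h3.
  have i40 : 0 < i2 / 4 by rewrite divr_gt0.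
  rewrite -(ler_pM2l i40); apply: le_trans h3 _.
  by move: h1 h2; move: (j.+1%:R^-1) (k.+1%:R^-1) => ej ek; lra.
suff hle : (h x <= (m - Q z x)%:E)%E.
  have dx : dom x.
    apply: contrapT => /not_dom hxy; move: hle; rewrite hxy leye_eq //.
  exists x; split=> // w dw; apply: le_trans (mle w dw).
  by move: hle; rewrite (hfin dx) lee_fin lerBrDr.
(* If [h x] were larger, lower semicontinuity would keep [h (u k)] above some [a'] that exceeds
   [m - Q z x] by [del]. The quadratic term loses at most [del / 2] near [x], and [u k] is within
   [del / 2] of the infimum, a contradiction. *)
rewrite leNgt; apply/negP => hlt.
have [a' ma' ha'] : exists2 a', m - Q z x < a' & (a'%:E < h x)%E.
  move: hlt; case: (h x) => [r||] //.
    rewrite lte_fin => hlt; exists ((m - Q z x + r) / 2); rewrite ?lte_fin; lra.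
  by move=> _; exists (m - Q z x + 1); rewrite ?ltry // ltrDl.
have [V /nbhs_ballP[r /= r0 rV] hV] := hlsc ha'.
pose del := a' - (m - Q z x); have del0 : 0 < del by rewrite subr_gt0.
pose c := 2 * i2 * fnorm (x - z) + 1.
have c0 : 0 < c by rewrite ltr_wpDl // !mulr_ge0 ?fnorm_ge0 // ltW.
have e0 : 0 < Num.min (r / 2) (del / 2 / c) by rewrite lt_min !divr_gt0.
have [N1 hN1] := hx _ e0.
have [|N2 hN2] := small (del / 2); first by rewrite divr_gt0.
pose k := maxn N1 N2.
have [dk hk] := hu k.
have := hN1 k (leq_maxl _ _); rewrite le_min => /andP[kr kc].
have hk2 := hN2 k (leq_maxr _ _).
have ak : a' < hr (u k).
  rewrite -lte_fin -(hfin dk); apply/hV/rV; rewrite -ball_normE /= distrC.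
  apply: le_lt_trans (mx_norm_le_fnorm _) _.
  by apply: le_lt_trans kr _; rewrite ltr_pdivrMr // ltr_pMr // ltr1n.
have : Q z x - c * fnorm (u k - x) <= Q z (u k).
  have -> : u k - z = (u k - x) + (x - z) by rewrite addrA subrK.
  rewrite (fdot_sqrD (u k - x) (x - z)).
  have h1 := fdot_ge0 (u k - x).
  have := fdot_CS_abs (u k - x) (x - z); rewrite ler_norml => /andP[h2 _].
  rewrite /c; set p := fnorm (u k - x) in h2 *.
  have p0 : 0 <= p := fnorm_ge0 _.
  move: p0 (ler_wpM2l (ltW i20) h2) (mulr_ge0 (ltW i20) h1); rewrite /p.
  by move: i2; dot_lra.
have : c * fnorm (u k - x) <= del / 2 by rewrite mulrC -ler_pdivlMr.
move: hk hk2 ak; clear hlt ha'; rewrite /del; clearbody c m.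
by move: (hr (u k)) (k.+1%:R^-1); dot_lra.
Qed.

Lemma prox_min z : argmin setT (prox_obj gam h z) (prox gam h z).
Proof.
apply: xgetPex; have [q [dq hq]] := prox_exists z.
exists q; split=> // w _; rewrite /prox_obj.
have [dw|/not_dom ->] := pselect (dom w); last first.
  by rewrite addye // leey.
rewrite (hfin dq) (hfin dw) -!EFinD lee_fin !fnorm_sqr.
exact: hq.
Qed.

Lemma prox_dom z : h (prox gam h z) \is a fin_num.
Proof.
have [_ hmin] := prox_min z; have [x hx] := hproper.2.
have dx : dom x by apply/fin_numP; split; [exact: hproper.1|exact: hx].
have := hmin x I; rewrite /prox_obj (hfin dx) -EFinD.
apply: contraTT; move/negP => /not_dom ->.
by rewrite addye // leye_eq.
Qed.

Lemma moreauE z :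
  moreau gam h z = hr (prox gam h z) + Q z (prox gam h z).
Proof.
rewrite -fnorm_sqr /moreau; have [_ hmin] := prox_min z.
suff -> : ereal_inf (range (prox_obj gam h z)) = prox_obj gam h z (prox gam h z).
  by rewrite /prox_obj [in LHS](hfin (prox_dom z)).
apply/eqP; rewrite eq_le; apply/andP; split.
  by apply: ereal_inf_lbound; exists (prox gam h z).
by apply: le_ereal_inf_tmp => _ [w _ <-]; exact: hmin.
Qed.

Opaque prox moreau.

Lemma moreau_le z w : dom w -> moreau gam h z <= hr w + Q z w.
Proof.
move=> dw; rewrite moreauE; have [_ /(_ w I)] := prox_min z.
by rewrite /prox_obj (hfin dw) (hfin (prox_dom z)) -!EFinD lee_fin !fnorm_sqr.
Qed.

(** The subgradient inequality at the proximal point: its value is compared with that at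
    [q + t *: d], the result is divided by [t], and [t] tends to 0. *)
Lemma prox_variational z w : dom w ->
  hr (prox gam h z) + gam^-1 * fdot (z - prox gam h z) (w - prox gam h z) <= hr w.
Proof.
move=> dw; set q := prox gam h z; set d := w - q.
have dq : dom q := prox_dom z.
have wE : w = q + d by rewrite /d addrC subrK.
apply: (@le_of_small _ _ (i2 * fdot d d)) => t /andP[t0 t1].
have [||dt ht] := @econvex_fine_seg q d t dq; [by rewrite -wE|by rewrite ltW|].
have := moreau_le z dt; rewrite moreauE -/q -wE in ht *.
have -> : q + t *: d - z = (q - z) + t *: d by rewrite addrAC.
have -> : z - q = - (q - z) by rewrite opprB.
rewrite !(fdotDl (q - z)) !(fdotDr _ (q - z)) !fdotZl !fdotZr !fdotNl.
rewrite (fdotC d (q - z)) => hh.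
rewrite -(ler_pM2l t0); have -> : gam^-1 = 2 * i2 by rewrite invfM mulrA divff // mul1r.
lra.
Qed.

Lemma prox_firm z z' (q := prox gam h z) (q' := prox gam h z') :
  fdot (q - q') (q - q') <= fdot (q - q') (z - z').
Proof.
have g0 : 0 < gam^-1 by rewrite invr_gt0.
move: (prox_variational z (prox_dom z')) (prox_variational z' (prox_dom z)).
rewrite -/q -/q'; clearbody q q'; move: (hr q) (hr q') (gam^-1) g0 => a b i i0.
rewrite -(opprB q q') fdotNr => h1 h2.
have : i * fdot (z' - q') (q - q') <= i * fdot (z - q) (q - q').
  by move: h1 h2; dot_lra.
rewrite ler_pM2l // [leRHS in _ -> _ <= leRHS]fdotC.
rewrite !(fdotDl _ _ (q - q')) !fdotNl; dot_lra.
Qed.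

Lemma prox_nonexpansive z z' :
  fnorm (prox gam h z - prox gam h z') <= fnorm (z - z').
Proof.
set p := _ - _; have [->|p0] := eqVneq p 0; first by rewrite fnorm0 fnorm_ge0.
have := le_trans (prox_firm z z') (fdot_CS _ _).
by rewrite -/p -fnorm_sqr expr2 ler_pM2l // fnorm_gt0.
Qed.

(** Each proximal point is a competitor for the other argument. The one of [z] gives the upper bound
    directly; the one of [z'] gives the lower bound up to the term [fdot (q' - q) (z' - z)], which
    nonexpansiveness controls. *)
Lemma moreau_expansion z z' :
  `|moreau gam h z' - moreau gam h z
    - fdot (gam^-1 *: (z - prox gam h z)) (z' - z)| <= i2 * fdot (z' - z) (z' - z).
Proof.
have h1 := moreau_le z' (prox_dom z).
have h2 := moreau_le z (prox_dom z').
rewrite ler_norml [moreau gam h z]moreauE [moreau gam h z']moreauE in h1 h2 *.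
have hn : fdot (prox gam h z' - prox gam h z) (z' - z) <= fdot (z' - z) (z' - z).
  apply: le_trans (fdot_CS _ _) _; rewrite -fnorm_sqr expr2.
  by rewrite ler_wpM2r ?fnorm_ge0 // prox_nonexpansive.
have gE : gam^-1 = 2 * i2 by rewrite invfM mulrA divff // mul1r.
move: h1 h2 (ler_wpM2l (ltW i20) hn); rewrite gE.
set q := prox gam h z; set q' := prox gam h z'.
have [a aE] : exists a, z' = z + a by exists (z' - z); rewrite addrC subrK.
have [p pE] : exists p, q' = q + p by exists (q' - q); rewrite addrC subrK.
have [b bE] : exists b, z = q + b by exists (z - q); rewrite addrC subrK.
rewrite aE pE bE.
have -> : q - (q + b + a) = - (b + a) by rewrite -addrA opprD addNKr.
have -> : q - (q + b) = - b by rewrite opprD addNKr.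
have -> : q + p - (q + b) = p - b by rewrite opprD addrACA subrr add0r.
have -> : q + p - (q + b + a) = p - b - a.
  by rewrite -[q + b + a]addrA opprD addrACA subrr add0r opprD addrA.
have -> : q + p - q = p by rewrite addrAC subrr add0r.
have -> : q + b + a - (q + b) = a by rewrite addrAC subrr add0r.
have -> : q + b - q = b by rewrite addrAC subrr add0r.
rewrite !fdotE (fdotC a b) (fdotC p b) (fdotC p a) .
move: (i2) (hr q) (hr q') => i a' b' h1 h2 h3; apply/andP.
by split; move: h1 h2 h3; dot_lra.
Qed.

(** Subgradients of a [G]-Lipschitz function have norm at most [G]; testing the subgradient
    inequality at [z] itself suffices here. *)
Lemma prox_lipschitz_bound z G : 0 <= G -> elipschitz G h ->
  fnorm (gam^-1 *: (z - prox gam h z)) <= G.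
Proof.
move=> G0 [hf hG]; set q := prox gam h z.
have g0 : 0 < gam^-1 by rewrite invr_gt0.
rewrite fnormZ ger0_norm ?(ltW g0) //.
have [->|zq] := eqVneq (z - q) 0; first by rewrite fnorm0 mulr0.
have := prox_variational z (hf z); rewrite -/q -fnorm_sqr => h1.
rewrite -(ler_pM2r (fnorm_gt0 zq)) -mulrA -expr2.
apply: le_trans (hG z q); apply: le_trans (ler_norm _); lra.
Qed.

End Proximal.

(** * Resolvents of symmetric matrices *)

Section SymmetricContractions.
Opaque fdot fnorm.
Context {R : realType} {n : nat}.
Implicit Types A J : 'M[R]_n.
Implicit Types u v w d q : 'cV[R]_n.
Implicit Types c m th : R.

Definition form_between m c A :=
  A^T = A /\ forall v, m * fdot v v <= fdot v (A *m v) <= c * fdot v v.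

(* If d and q are increments of the argument and of the value of a firmly
   nonexpansive map, J plays the role of its Jacobian. *)
Lemma firm_secant q d : fdot q q <= fdot q d ->
  exists2 J, form_between 0 1 J & q = J *m d.
Proof.
(* A rank-one matrix sending [d] to [q]; its form is at most 1 because [fdot q q <= fdot q d]. If
   [fdot q d = 0] then [q = 0], and the convention [0^-1 = 0] still gives a correct [J]. *)
move=> qd; exists ((fdot q d)^-1 *: (q *m q^T)); last first.
  have [q0|q0] := eqVneq q 0; first by rewrite q0 mul0mx scaler0 mul0mx.
  have qd0 : 0 < fdot q d.
    by apply: lt_le_trans qd; rewrite -fnorm_sqr exprn_gt0 // fnorm_gt0.
  rewrite -scalemxAl -mulmxA [q^T *m d]mx11_scalar mul_mx_scalar scalerA.
  by rewrite fdot_vecE mulVf ?scale1r // gt_eqF.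
split; first by rewrite linearZ /= trmx_mul trmxK.
move=> v; rewrite -scalemxAl fdotZr (fdotC v) -mulmxA.
have -> : fdot (q *m (q^T *m v)) v = fdot q v ^+ 2.
  by rewrite [q^T *m v]mx11_scalar mul_mx_scalar fdotZl expr2 fdot_vecE.
rewrite mul0r mul1r; have q0 := fdot_ge0 q; have qd0 := le_trans q0 qd.
rewrite mulr_ge0 ?sqr_ge0 ?invr_ge0 //=.
have [->|qdn] := eqVneq (fdot q d) 0; first by rewrite invr0 mul0r fdot_ge0.
rewrite mulrC ler_pdivrMr ?lt_neqAle ?qd0 ?andbT 1?eq_sym //.
apply: (@le_trans _ _ (fdot q q * fdot v v)).
  rewrite -!fnorm_sqr -exprMn -[fdot q v ^+ 2]real_normK ?num_real //.
  by rewrite ler_pXn2r ?nnegrE ?mulr_ge0 ?fnorm_ge0 // fdot_CS_abs.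
by rewrite mulrC ler_wpM2l ?fdot_ge0.
Qed.

Lemma form_between_norm c A v : 0 <= c -> form_between 0 c A ->
  fnorm (A *m v) <= c * fnorm v.
Proof.
move=> c0 [As hA]; apply: psd_mulmx_norm => // u.
by have := hA u; rewrite mul0r.
Qed.

Section Resolvent.
Variables (A : 'M[R]_n) (m th : R).
Hypotheses (m0 : 0 <= m) (m1 : m <= 1) (th0 : 0 <= th).
Hypothesis hA : form_between m 1 A.

(** Differentiating [p + th gam grad f(p) = x] gives [(I + th A) p' = I], so this is the derivative
    of [p]. Applying [I - A] to it, as [damped_resolvent] does, gives the derivative of the forward
    step [p - gam grad f(p)]. *)
Definition resolvent := invmx (1%:M + th *: A).
Definition damped_resolvent := (1%:M - A) *m resolvent.
Local Notation S := resolvent.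
Local Notation B := damped_resolvent.
Local Notation K := (1%:M + th *: A).

Let thm0 : 0 < 1 + th * m.
Proof. by rewrite ltr_pwDl // mulr_ge0. Qed.

Let Ksym : K^T = K.
Proof. by rewrite linearD /= linearZ /= trmx1 hA.1. Qed.

Let K_lower v : (1 + th * m) * fnorm v <= fnorm (K *m v).
Proof.
have [->|v0] := eqVneq v 0; first by rewrite mulmx0 fnorm0 mulr0.
rewrite -(ler_pM2r (fnorm_gt0 v0)) -mulrA -expr2 fnorm_sqr.
apply: le_trans (fdot_CS _ _); rewrite fdotC mulmxDl mul1mx -scalemxAl.
rewrite fdotDr fdotZr mulrDl mul1r lerD2l -mulrA ler_wpM2l //.
by have /andP[] := hA.2 v.
Qed.

Let Kunit : K \in unitmx.
Proof.
rewrite -row_free_unit; apply: inj_row_free => v vK.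
have : fnorm (K *m v^T) = 0 by rewrite -{1}Ksym -trmx_mul vK trmx0 fnorm0.
have := K_lower v^T => + E; rewrite E pmulr_rle0 // => hv.
have : fnorm v^T = 0 by apply/eqP; rewrite eq_le hv fnorm_ge0.
by move/fnorm_eq0 => /(congr1 trmx); rewrite trmxK trmx0.
Qed.

Lemma mul_resolvent : K *m S = 1%:M. Proof. exact: mulmxV. Qed.
Lemma resolvent_mul : S *m K = 1%:M. Proof. exact: mulVmx. Qed.

Lemma resolvent_sym : S^T = S.
Proof. by rewrite trmx_inv Ksym. Qed.

Lemma damped_resolventE : B = (1%:M - A) *m S. Proof. by []. Qed.

Lemma damped_resolvent_comm : B = S *m (1%:M - A).
Proof.
have hc : K *m (1%:M - A) = (1%:M - A) *m K.
  rewrite mulmxDl mul1mx [in RHS]mulmxDr [in RHS]mulmx1 -scalemxAl -scalemxAr.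
  by congr (_ + _ *: _); rewrite mulmxBl mulmxBr mul1mx mulmx1.
have -> : S *m (1%:M - A) = S *m (K *m (1%:M - A)) *m S.
  by rewrite hc -!mulmxA mul_resolvent mulmx1.
by rewrite mulmxA resolvent_mul mul1mx.
Qed.

Lemma damped_resolvent_sym : B^T = B.
Proof.
rewrite [RHS]damped_resolvent_comm /damped_resolvent trmx_mul resolvent_sym.
by rewrite linearB /= trmx1 hA.1.
Qed.

Lemma resolvent_norm v : (1 + th * m) * fnorm (S *m v) <= fnorm v.
Proof. by rewrite -[in leRHS](mul1mx v) -mul_resolvent -mulmxA. Qed.

Lemma resolvent_norm1 v : fnorm (S *m v) <= fnorm v.
Proof.
apply: le_trans (resolvent_norm v).
by rewrite ler_peMl ?fnorm_ge0 // lerDl mulr_ge0.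
Qed.

Lemma form_between_onem : form_between 0 1 (1%:M - A).
Proof.
split=> [|v]; first by rewrite linearB /= trmx1 hA.1.
have /andP[h1 h2] := hA.2 v; have := mulr_ge0 m0 (fdot_ge0 v).
rewrite mulmxBl mul1mx fdotDr fdotNr => h3; apply/andP.
by split; move: h1 h2 h3; dot_lra.
Qed.

Lemma damped_resolvent_norm v : fnorm (B *m v) <= fnorm v.
Proof.
rewrite /damped_resolvent -mulmxA; apply: le_trans (resolvent_norm1 v).
by rewrite -[leRHS]mul1r form_between_norm //; exact: form_between_onem.
Qed.

Opaque damped_resolvent.

(** Bounding the two products separately would lose the constant. With [u = S w], the form of this
    symmetric matrix is [<u, (I - A) u> - <B w, J B w>]. It is nonnegative because [B w = (I - A) u]
    and both [I - A] and [J] lie between 0 and [I]; for the upper bound the [J] term is dropped. *)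
Lemma damped_secant_norm J v : form_between 0 1 J ->
  fnorm ((B *m S - B *m J *m B) *m v)
    <= (1 - m) / (1 + th * m) ^+ 2 * fnorm v.
Proof.
move=> hJ; set c := _ / _.
have c0 : 0 <= c by rewrite divr_ge0 ?subr_ge0 ?sqr_ge0.
apply: form_between_norm => //; split.
  rewrite linearB /= (trmx_mul B S) (trmx_mul (B *m J) B) (trmx_mul B J).
  rewrite damped_resolvent_sym resolvent_sym hJ.1.
  congr (_ - _); last by rewrite mulmxA.
  by rewrite [in RHS]damped_resolvent_comm damped_resolventE mulmxA.
move=> w; set u := S *m w.
have Bw : B *m w = (1%:M - A) *m u by rewrite damped_resolventE -mulmxA.
have -> : fdot w ((B *m S - B *m J *m B) *m w) =
    fdot u ((1%:M - A) *m u) - fdot (B *m w) (J *m (B *m w)).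
  rewrite mulmxBl fdotDr fdotNr -(mulmxA B S w) -(mulmxA (B *m J) B w).
  rewrite -(mulmxA B J (B *m w)); congr (_ - _).
    by rewrite -{1}damped_resolvent_sym -(fdot_mulmxl B) Bw fdotC.
  by rewrite -{1}damped_resolvent_sym -(fdot_mulmxl B).
have [asym hu] := form_between_onem.
have h1 : fdot (B *m w) (B *m w) <= 1 * fdot u ((1%:M - A) *m u).
  rewrite Bw; apply: psd_mulmx_sqr => // z.
  by have := hu z; rewrite mul0r.
have /andP[h2 h3] := hJ.2 (B *m w).
have h4 : fdot u ((1%:M - A) *m u) <= (1 - m) * fdot u u.
  have /andP[h5 _] := hA.2 u.
  by rewrite mulmxBl mul1mx fdotDr fdotNr; move: h5; dot_lra.
have h5 : (1 + th * m) ^+ 2 * fdot u u <= fdot w w.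
  rewrite -!fnorm_sqr -exprMn ler_pXn2r ?nnegrE ?mulr_ge0 ?fnorm_ge0 ?(ltW thm0) //.
  exact: resolvent_norm.
have h6 : (1 - m) * fdot u u <= c * fdot w w.
  rewrite /c -mulrA ler_wpM2l ?subr_ge0 // mulrC ler_pdivlMr ?exprn_gt0 //.
  by rewrite mulrC.
apply/andP; split; [move: h1 h2 h3|move: h2 h4 h6]; dot_lra.
Qed.

End Resolvent.

Opaque resolvent damped_resolvent.

(** A resolvent identity: with both terms written as [S' *m _ *m S], the products [A' *m A] cancel
    and [(1 + th) *: (A - A')] remains between the resolvents. *)
Lemma damped_resolvent_sub A A' m th : 0 <= m -> m <= 1 -> 0 <= th ->
  form_between m 1 A -> form_between m 1 A' ->
  damped_resolvent A' th - damped_resolvent A th =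
  (1 + th) *: (resolvent A' th *m (A - A') *m resolvent A th).
Proof.
move=> m0 m1 th0 hA hA'.
rewrite (damped_resolvent_comm m0 th0 hA').
set S := resolvent A th; set S' := resolvent A' th.
have e1 : S' *m (1%:M - A') = S' *m (1%:M - A') *m (1%:M + th *: A) *m S.
  by rewrite -[RHS]mulmxA (mul_resolvent m0 th0 hA) mulmx1.
have e2 : damped_resolvent A th = S' *m (1%:M + th *: A') *m (1%:M - A) *m S.
  by rewrite (resolvent_mul m0 th0 hA') mul1mx.
rewrite scalemxAl scalemxAr e1 e2 -mulmxBl; congr (_ *m S).
rewrite -![S' *m _ *m _]mulmxA -mulmxBr; congr (S' *m _).
rewrite !mulmxDl !mulNmx !mulmxDr !mulmxN !mul1mx !mulmx1.
rewrite -!scalemxAl -!scalemxAr.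
move: (A' *m A) => C; apply/matrixP => i j; rewrite !mxE; ring.
Qed.

End SymmetricContractions.

(* A second-order error term disappears when the segment is cut into N pieces. *)
Lemma lipschitz_of_second_order {R : realType} {n : nat}
    (A : set 'cV[R]_n) (F : 'cV[R]_n -> 'cV[R]_n) (a b : R) :
  @convex_set R 'cV[R]_n A ->
  (forall x y, A x -> A y ->
     fnorm (F y - F x) <= a * fnorm (y - x) + b * fnorm (y - x) ^+ 2) ->
  forall x y, A x -> A y -> fnorm (F y - F x) <= a * fnorm (y - x).
Proof.
move=> Ac hF x y Ax Ay; set d := y - x.
have step (N : nat) : (0 < N)%N ->
    fnorm (F y - F x) <= a * fnorm d + N%:R^-1 * (b * fnorm d ^+ 2).
  move=> N0; have N0' : 0 < N%:R :> R by rewrite ltr0n.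
  pose z k := x + (k%:R / N%:R) *: d.
  have Az k : (k <= N)%N -> A (z k).
    move=> kN; apply: segment_mem => //.
    by rewrite divr_ge0 //= ler_pdivrMr // mul1r ler_nat.
  have zS k : z k.+1 - z k = N%:R^-1 *: d.
    rewrite /z opprD addrACA subrr add0r -scalerBl -mulrBl -natrB //.
    by rewrite subSnn mul1r.
  have ind k : (k <= N)%N -> fnorm (F (z k) - F x) <=
      k%:R * (a * (N%:R^-1 * fnorm d) + b * (N%:R^-1 * fnorm d) ^+ 2).
    elim: k => [_|k ih kN].
      by rewrite /z mul0r scale0r addr0 subrr fnorm0 mul0r.
    apply: le_trans (ler_fnorm_dist _ (F (z k)) _) _.
    rewrite -natr1 mulrDl mul1r addrC lerD ?ih 1?ltnW //.
    apply: le_trans (hF _ _ (Az k (ltnW kN)) (Az k.+1 kN)) _.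
    by rewrite zS fnormZ ger0_norm // invr_ge0 ltW.
  have zN : z N = y by rewrite /z divff ?gt_eqF // scale1r /d addrC subrK.
  have := ind N (leqnn N); rewrite zN => /le_trans; apply.
  rewrite exprMn (_ : N%:R * _ = N%:R * N%:R^-1 *
    (a * fnorm d + N%:R^-1 * (b * fnorm d ^+ 2))); last by ring.
  by rewrite divff ?gt_eqF // mul1r.
apply/ler_addgt0Pr => e e0; set c := b * fnorm d ^+ 2 in step.
pose N := (Num.bound (`|c| / e)).+1.
apply: le_trans (step N isT) _; rewrite lerD2l mulrC ler_pdivrMr //.
apply: le_trans (ler_norm c) _; rewrite mulrC -ler_pdivrMr //.
have := archi_boundP (divr_ge0 (normr_ge0 c) (ltW e0)) => /ltW /le_trans; apply.
by rewrite ler_nat.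
Qed.

(** * The envelope and its gradient *)

Section Envelope.
Opaque grad hess fdot fnorm prox moreau resolvent damped_resolvent.
Context {R : realType} {n : nat}.
Implicit Types x y z v w d : 'cV[R]_n.
Implicit Types e t m c : R.

Definition relax (s : splitting) : R := match s with FB => 0 | DR => 1 end.

Variables (s : splitting) (f : 'cV[R]_n -> R) (g : 'cV[R]_n -> \bar R) (L gam : R).
Hypothesis L0 : 0 < L.
Hypothesis fconvex : @convex_function R 'cV[R]_n setT f.
Hypothesis fsmooth : smooth L f.
Hypothesis gproper : eproper g.
Hypothesis glsc : lower_semicontinuous g.
Hypothesis gconvex : econvex g.
Hypothesis gam0 : 0 < gam.
Hypothesis gamL : gam * L < 1.

Local Notation df := (grad f).
Local Notation th := (relax s).
Local Notation p := (pmap_of s f gam).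
Local Notation T := (split_op s f g gam).
Local Notation env := (envelope s f g gam).
Local Notation u y := (y - gam *: df y).
Local Notation Q y := (prox gam g (y - gam *: grad f y)).
Local Notation i2 := ((2 * gam)^-1).

Definition fb_envelope y : R :=
  f y - gam / 2 * fdot (df y) (df y) + moreau gam g (u y).
Local Notation FBE := fb_envelope.

Let th0 : 0 <= th. Proof. by case: s => /=. Qed.
Let th1 : th <= 1. Proof. by case: s => /=. Qed.
Let gi : gam * gam^-1 = 1. Proof. by rewrite divff // gt_eqF. Qed.
Let i20 : 0 < i2. Proof. by rewrite invr_gt0 mulr_gt0. Qed.
Let i2E : gam^-1 = 2 * i2. Proof. by rewrite invfM mulrA divff // mul1r. Qed.

(** * Reduction of both splittings to the forward-backward envelope *)

Let fproper : eproper (EFin \o f).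
Proof. by split=> //; exists 0. Qed.

Let flsc : lower_semicontinuous (EFin \o f).
Proof.
apply: continuous_lower_semicontinuous => x.
exact/differentiable_continuous/fsmooth.1.
Qed.

Let feconvex : econvex (EFin \o f).
Proof.
move=> x y t t01; rewrite /= -!EFinM -EFinD lee_fin.
by have /convex_functionP := fconvex; apply.
Qed.

(** The optimality defect [D] vanishes: at the gradient step [q - L^-1 *: D], the subgradient
    inequality from below and the descent lemma from above leave [fdot D D] at most half of
    itself. *)
Lemma prox_smooth x :
  prox gam (EFin \o f) x + gam *: df (prox gam (EFin \o f) x) = x.
Proof.
set q := prox _ _ _; set D := df q - gam^-1 *: (x - q).
suff D0 : D = 0.
  have -> : df q = gam^-1 *: (x - q) by apply/eqP; rewrite -subr_eq0 -/D D0.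
  by rewrite scalerA gi scale1r addrC subrK.
have h1 := @prox_variational _ _ _ _ gam0 fproper flsc feconvex x (q - L^-1 *: D) isT.
have h2 := descent_lemma fsmooth q (q - L^-1 *: D).
have LL : L * L^-1 = 1 by rewrite divff // gt_eqF.
have Li0 : 0 < L^-1 by rewrite invr_gt0.
apply: fnorm_eq0; apply/eqP; rewrite -sqrf_eq0 fnorm_sqr eq_le fdot_ge0 andbT.
move: (le_trans h1 h2); rewrite -/q /= [q - _ - q]addrAC subrr add0r.
rewrite fdotNr !fdotNr fdotNl !fdotZr fdotZl opprK.
have DE : fdot D D = fdot (df q) D - gam^-1 * fdot (x - q) D.
  by rewrite {1}/D fdotDl fdotNl fdotZl.
move: (fdot (df q) D) (fdot (x - q) D) (fdot D D) (gam^-1) (f q) DE => a b c i fq DE.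
have -> : L / 2 * (L^-1 * (L^-1 * c)) = (L * L^-1) * L^-1 * c / 2 by ring.
rewrite LL => h; rewrite -(pmulr_rle0 _ Li0) DE; move: h; rewrite DE.
move: (L^-1) => l h; nra.
Qed.

Lemma moreau_smoothE x (q := prox gam (EFin \o f) x) :
  moreau gam (EFin \o f) x = f q + gam / 2 * fdot (df q) (df q).
Proof.
rewrite moreauE // -/q /=.
have -> : q - x = - (gam *: df q).
  by rewrite -{1}(prox_smooth x) -/q opprD addNKr.
rewrite fdotNl fdotNr opprK fdotZl fdotZr; congr (_ + _).
by move: (fdot _ _) => c; field; rewrite gt_eqF.
Qed.

Lemma moreau_smooth_grad x :
  grad (moreau gam (EFin \o f)) x = df (prox gam (EFin \o f) x).
Proof.
apply: has_grad_gradE; apply: (@quadratic_has_grad _ _ _ _ _ i2) => y.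
have := @moreau_expansion _ _ _ _ gam0 fproper flsc feconvex x y.
have -> : gam^-1 *: (x - prox gam (EFin \o f) x) = df (prox gam (EFin \o f) x).
  rewrite -{1}(prox_smooth x) [_ + gam *: _ - _]addrAC subrr add0r scalerA.
  by rewrite mulrC gi scale1r.
by [].
Qed.

Lemma pmap_fix x : p x + (th * gam) *: df (p x) = x.
Proof.
rewrite /pmap_of; case: s => /=; first by rewrite mul0r scale0r addr0.
by rewrite mul1r prox_smooth.
Qed.

Lemma residualE x : x - T x = p x - Q (p x).
Proof.
rewrite /split_op opprB addrC subrK; congr (_ - _).
rewrite /qmap_of /pmap_of; case: s; first by [].
set q := prox gam (EFin \o f) x; congr (prox gam g _).
by rewrite -[X in _ - X](prox_smooth x) -/q scaler_nat mulr2n opprD addrA addrK.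
Qed.

Lemma envelopeE x : env x = FBE (p x).
Proof.
rewrite /envelope /fb_envelope /pmap_of; case: s.
  by rewrite fnorm_sqr.
rewrite moreau_smoothE moreau_smooth_grad fnorm_sqr.
set q := prox gam (EFin \o f) x; congr (_ + moreau gam g _).
  by move: (f q) (fdot _ _) => a b; field.
rewrite -[X in X - _](prox_smooth x) -/q mulrC mulr_natr mulr2n scalerDl opprD.
by rewrite addrA addrK.
Qed.

Lemma pmap_displacement x y :
  y - x = (p y - p x) + (th * gam) *: (df (p y) - df (p x)).
Proof.
by rewrite -{1}(pmap_fix y) -{1}(pmap_fix x) scalerBr opprD addrACA.
Qed.

Lemma pmap_strong_nonexpansive mu x y : 0 <= mu ->
  mu * fdot (p y - p x) (p y - p x)
    <= fdot (df (p y) - df (p x)) (p y - p x) ->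
  (1 + th * (gam * mu)) * fnorm (p y - p x) <= fnorm (y - x).
Proof.
move=> mu0 hmu; set h := p y - p x in hmu *.
have [->|hn0] := eqVneq h 0; first by rewrite fnorm0 mulr0 fnorm_ge0.
rewrite -(ler_pM2r (fnorm_gt0 hn0)) -mulrA -expr2 fnorm_sqr.
apply: le_trans (fdot_CS _ _); rewrite (pmap_displacement x y) -/h.
rewrite fdotDl fdotZl mulrDl mul1r lerD2l -!mulrA ler_wpM2l // ler_wpM2l //.
exact: ltW.
Qed.

Lemma pmap_nonexpansive x y : fnorm (p y - p x) <= fnorm (y - x).
Proof.
have := @pmap_strong_nonexpansive 0 x y (lexx _).
by rewrite mul0r !mulr0 addr0 mul1r; apply; exact: (grad_monotone L0).
Qed.

(** * Minimality of fixed points, and decrease along [T] *)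

Lemma grad_lipschitz x y : fnorm (df y - df x) <= L * fnorm (y - x).
Proof. exact: fsmooth.2. Qed.

(** Completing the square merges [- gam / 2 |grad f|^2] with the proximal penalty: the envelope is
    the minimum over [w] of [f + g] with [f] linearized at [y] and a quadratic penalty added.
    [fb_envelopeE] is the equality at the minimizer. *)
Lemma fb_envelope_le y w : g w \is a fin_num ->
  FBE y <= f y + fdot (df y) (w - y) + fine (g w) + i2 * fdot (w - y) (w - y).
Proof.
move=> gw; have := moreau_le gam0 gproper glsc gconvex (u y) gw.
have -> : w - u y = (w - y) + gam *: df y by rewrite opprB addrA addrAC.
rewrite /fb_envelope fdot_sqrD !fdotZr fdotZl [fdot (w - y) (df y)]fdotC.
move: (fdot (w - y) (w - y)) (fdot (df y) (w - y)) (fdot (df y) (df y)).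
move=> a b c; move: (moreau _ _ _) (f y) (fine _) => m' fy gw'.
have -> : i2 * (a + 2 * (gam * b) + gam * (gam * c)) =
  i2 * a + b + gam / 2 * c by field; rewrite gt_eqF.
move: (i2) => i; lra.
Qed.

Lemma fb_envelopeE y : FBE y = f y + fdot (df y) (Q y - y) + fine (g (Q y))
  + i2 * fdot (Q y - y) (Q y - y).
Proof.
rewrite /fb_envelope moreauE //; set w := Q y.
have -> : w - u y = (w - y) + gam *: df y by rewrite opprB addrA addrAC.
rewrite fdot_sqrD !fdotZr fdotZl [fdot (w - y) (df y)]fdotC.
move: (fdot (w - y) (w - y)) (fdot (df y) (w - y)) (fdot (df y) (df y)) => a b c.
have -> : i2 * (a + 2 * (gam * b) + gam * (gam * c)) =
  i2 * a + b + gam / 2 * c by field; rewrite gt_eqF.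
by move: (i2) (f y) (fine _) => i fy gw; ring.
Qed.

Let Li2 : L / 2 <= i2.
Proof.
rewrite invfM mulrC ler_wpM2l //.
by rewrite -(ler_pM2l gam0) gi ltW.
Qed.

Lemma envelope_lower x : f (Q (p x)) + fine (g (Q (p x))) <= env x.
Proof.
rewrite envelopeE fb_envelopeE; set y := p x; set w := Q y.
have := descent_lemma fsmooth y w.
have := ler_wpM2r (fdot_ge0 (w - y)) Li2.
by move: (f y) (f w) (fine _) (i2); dot_lra.
Qed.

(** At a fixed point the envelope equals [f + g] at [p xs], which minimizes [f + g] by the
    subgradient inequalities of both functions; at any [x] it dominates [f + g] at the
    forward-backward point. *)
Lemma envelope_fixpoint_min xs x : T xs = xs -> env xs <= env x.
Proof.
move=> Txs; set ps := p xs; set w := Q (p x).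
have psQ : Q ps = ps.
  by apply/esym/eqP; rewrite -subr_eq0 -residualE Txs subrr.
have gps : g ps \is a fin_num by rewrite -{1}psQ; exact: prox_dom.
have gw : g w \is a fin_num by exact: prox_dom.
apply: le_trans (envelope_lower x); rewrite envelopeE -/ps -/w fb_envelopeE psQ.
rewrite subrr !fdot0r mulr0 !addr0.
have := prox_variational gam0 gproper glsc gconvex (u ps) gw.
have := convex_grad_le fsmooth fconvex ps w; rewrite psQ.
have -> : u ps - ps = - (gam *: df ps) by rewrite addrAC subrr add0r.
rewrite fdotNl fdotZl mulrN mulrA [gam^-1 * _]mulrC gi mul1r.
by move: (f ps) (f w) (fine (g ps)) (fine (g w)); dot_lra.
Qed.

(** The numerator is the margin of the descent lemma when [gam < 1/L]; the denominator comes from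
    [|x - T x| <= (1 + th gam L) |p x - p (T x)|]. *)
Definition decrease_rate := (i2 - L / 2) / (1 + th * gam * L) ^+ 2.

Lemma decrease_rate_gt0 : 0 < decrease_rate.
Proof.
have h1 : 0 < 1 + th * gam * L by rewrite ltr_wpDr // !mulr_ge0 // ltW.
have hL : L < gam^-1 by rewrite -(ltr_pM2l gam0) gi.
rewrite divr_gt0 ?exprn_gt0 // subr_gt0.
by move: hL; rewrite i2E; move: (i2) => i; lra.
Qed.

(** The forward-backward point [w] of [x] competes in the model at [y' = p (T x)], from which it
    differs by [th gam del]. After expansion the terms in [del] add up to
    [th (<del, d> - gam <del, del>)], nonnegative by cocoercivity. *)
Lemma envelope_decrease x :
  env (T x) <= env x - decrease_rate * fdot (x - T x) (x - T x).
Proof.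
set y := p x; set y' := p (T x); set d := y - y'; set del := df y - df y'.
set r := x - T x; set w := Q y.
have rE : r = d + (th * gam) *: del by exact: pmap_displacement.
have ry : w - y = - r by rewrite /r residualE opprB.
have wE : w - y' = - ((th * gam) *: del).
  have -> : w - y' = d + (w - y) by rewrite /d [RHS]addrC addrA subrK.
  by rewrite ry rE opprD addrA subrr add0r.
have gw : g w \is a fin_num by exact: prox_dom.
have dfy : df y = df y' + del by rewrite /del addrC subrK.
have h1 := fb_envelope_le y' gw.
have h2 := descent_lemma fsmooth y y'.
have h3 : gam * fdot del del <= fdot del d.
  apply: le_trans (cocoercive L0 fsmooth fconvex y' y).
  rewrite ler_wpM2r ?fdot_ge0 // -(ler_pM2r L0) mulVf ?gt_eqF //; exact: ltW.
have h4 : decrease_rate * fdot r r <= (i2 - L / 2) * fdot d d.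
  have th1p : 0 < 1 + th * gam * L by rewrite ltr_wpDr // !mulr_ge0 // ltW.
  rewrite /decrease_rate -mulrA ler_wpM2l ?subr_ge0 //.
  rewrite mulrC ler_pdivrMr ?exprn_gt0 // mulrC -!fnorm_sqr -exprMn.
  rewrite ler_pXn2r ?nnegrE ?mulr_ge0 ?fnorm_ge0 ?(ltW th1p) //.
  rewrite rE; apply: le_trans (ler_fnormD _ _) _.
  rewrite mulrDl mul1r lerD2l fnormZ ger0_norm ?mulr_ge0 ?(ltW gam0) //.
  by rewrite -[leRHS]mulrA ler_wpM2l ?mulr_ge0 ?(ltW gam0) // grad_lipschitz.
have e1 : env (T x) = FBE y' := envelopeE _.
have e2 : env x = f y + fdot (df y) (w - y) + fine (g w)
    + i2 * fdot (w - y) (w - y) := etrans (envelopeE x) (fb_envelopeE y).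
rewrite e1 e2; clear e1 e2.
have yy : y' - y = - d by rewrite opprB.
move: h1 h2 h4; rewrite wE ry yy dfy.
move: (f y) (f y') (fine (g w)) (df y') (FBE y') => a a' c b F.
clear dfy yy wE ry gw; clearbody r del d; clear w y y'.
rewrite rE; clear rE.
rewrite !fdotNr !fdotNl !opprK !(fdot_sqrD d).
rewrite !(fdotDl b del) !(fdotDr _ d) !fdotZr !fdotZl (fdotC d del).
have i2g : i2 * gam = 2^-1 by rewrite invfM -mulrA mulVf ?mulr1 // gt_eqF.
have h3' := ler_wpM2l th0 h3.
move: (fdot b d) (fdot b del) (fdot del d) (fdot del del) (fdot d d) h3' => bd be D E dd h3'.
have -> : i2 * (dd + 2 * (th * gam * D) + th * gam * (th * gam * E)) =
  i2 * dd + 2 * th * (i2 * gam) * D + i2 * (th * gam * (th * gam * E)) by ring.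
rewrite i2g; move: h3' (decrease_rate) (i2) => + rate i.
by move: th => t; lra.
Qed.

(** The increment of [grad f] is left unlinearized, so that a quadratic error follows from the
    Lipschitz gradient alone. The Hessian enters in [envelope_has_grad], where a little-o error
    suffices. *)
Lemma fb_envelope_expansion : exists2 C, 0 <= C & forall y z,
  `|FBE z - FBE y - fdot (gam^-1 *: (y - Q y)) ((z - y) - gam *: (df z - df y))|
    <= C * fdot (z - y) (z - y).
Proof.
exists (L / 2 + gam / 2 * L ^+ 2 + i2 * (1 + gam * L) ^+ 2).
  have l0 := ltW L0; have g0 := ltW gam0.
  by rewrite !addr_ge0 // mulr_ge0 ?sqr_ge0 // ?divr_ge0 // ltW.
move=> y z; set h := z - y; set e := df z - df y.
have uu : u z - u y = h - gam *: e.
  by rewrite /h /e scalerBr !opprD !opprK addrACA.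
have := moreau_expansion gam0 gproper glsc gconvex (u y) (u z).
rewrite uu => h1.
have h2 := descent_lemma fsmooth y z.
have h3 := convex_grad_le fsmooth fconvex y z.
have eL : fnorm e <= L * fnorm h := grad_lipschitz y z.
have e2 : fdot e e <= L ^+ 2 * fdot h h.
  by rewrite -!fnorm_sqr -exprMn ler_pXn2r ?nnegrE ?mulr_ge0 ?fnorm_ge0 ?(ltW L0).
have h4 : fdot (h - gam *: e) (h - gam *: e) <= (1 + gam * L) ^+ 2 * fdot h h.
  have gL0 : 0 <= 1 + gam * L by rewrite addr_ge0 // mulr_ge0 // ltW.
  rewrite -!fnorm_sqr -exprMn ler_pXn2r ?nnegrE ?mulr_ge0 ?fnorm_ge0 //.
  apply: le_trans (ler_fnormB _ _) _; rewrite mulrDl mul1r lerD2l fnormZ.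
  by rewrite ger0_norm ?(ltW gam0) // -mulrA ler_wpM2l // ltW.
have dfz : df z = df y + e by rewrite /e addrC subrK.
have uq q : gam^-1 *: (u y - q) = gam^-1 *: (y - q) - df y.
  by rewrite addrAC scalerBr scalerA mulVf ?gt_eqF // scale1r.
move: h1; rewrite uq /fb_envelope dfz => h1.
have {}h4 := ler_wpM2l (ltW i20) h4.
have {}e2 : gam / 2 * fdot e e <= gam / 2 * (L ^+ 2 * fdot h h).
  by rewrite ler_wpM2l // divr_ge0 // ltW.
move: h1 h2 h3 h4 e2 (mulr_ge0 (ltW (divr_gt0 gam0 (ltr0Sn R 1))) (fdot_ge0 e)).
clear dfz uq eL uu; rewrite -/h.
move: (df y) (moreau gam g (u y)) (f y) (f z) (gam^-1 *: _).
move=> b my fy fz r; clearbody h e.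
rewrite (fdotDl r) fdotNl (fdot_sqrD b) (fdotDr b h) fdotNr fdotZr.
move: (moreau _ _ _) (fdot (h - gam *: e) _) (fdot r _) => mz hh rr.
rewrite !ler_norml => /andP[h1 h1'] h2 h3 h4 e2 e0; apply/andP.
by split; [move: h1|move: h1']; move: h2 h3 h4 e2 e0; move: (i2) => i; dot_lra.
Qed.

(** * Gradient of the envelope *)

Local Notation A y := (gam *: hess f y).
Local Notation S y := (resolvent (A y) th).
Local Notation B y := (damped_resolvent (A y) th).

Definition envelope_grad x := gam^-1 *: (B (p x) *m (x - T x)).
Definition hess_error x y :=
  gam *: (df (p y) - df (p x)) - A (p x) *m (p y - p x).
Local Notation err := hess_error.

(** An exact identity, with the Taylor error [err] kept explicit. It serves twice: with a little-o
    error for differentiability, and with a quadratic error for the Lipschitz constant. *)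
Lemma pmap_linearization m x y : 0 <= m -> form_between m 1 (A (p x)) ->
  p y - p x = S (p x) *m (y - x) - th *: (S (p x) *m err x y).
Proof.
move=> m0 hA; rewrite (pmap_displacement x y) -scalerA.
have -> : gam *: (df (p y) - df (p x)) = A (p x) *m (p y - p x) + err x y.
  by rewrite /hess_error [RHS]addrC subrK.
move: (p y - p x) (err x y) => h r; rewrite scalerDr scalemxAl addrA.
rewrite mulmxDr scalemxAr addrK -[X in X + _](mul1mx h) -mulmxDl mulmxA.
by rewrite (resolvent_mul m0 th0 hA) mul1mx.
Qed.

Lemma forward_linearization m x y : 0 <= m -> form_between m 1 (A (p x)) ->
  (p y - p x) - gam *: (df (p y) - df (p x)) =
  B (p x) *m (y - x) - (th *: (B (p x) *m err x y) + err x y).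
Proof.
move=> m0 hA.
have -> : gam *: (df (p y) - df (p x)) = A (p x) *m (p y - p x) + err x y.
  by rewrite /hess_error [RHS]addrC subrK.
have h := pmap_linearization y m0 hA.
rewrite opprD addrA -{1}(mul1mx (p y - p x)) -mulmxBl {1}h.
rewrite mulmxBr -scalemxAr !mulmxA -(damped_resolventE (A (p x)) th).
by rewrite [in RHS]opprD [RHS]addrA.
Qed.

Lemma hess_error_norm c x y : 0 <= c ->
  fnorm (df (p y) - df (p x) - hess f (p x) *m (p y - p x))
    <= c * fnorm (p y - p x) ->
  fnorm (err x y) <= gam * c * fnorm (y - x).
Proof.
move=> c0 h; have -> : err x y = gam *: (df (p y) - df (p x)
    - hess f (p x) *m (p y - p x)) by rewrite /hess_error [RHS]scalerBr -scalemxAl.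
rewrite fnormZ ger0_norm ?(ltW gam0) // -mulrA ler_wpM2l ?(ltW gam0) //.
apply: le_trans h _; rewrite ler_wpM2l //; exact: pmap_nonexpansive.
Qed.

Lemma envelope_has_grad m x : differentiable df (p x) ->
  0 <= m -> form_between m 1 (A (p x)) -> has_grad env x (envelope_grad x).
Proof.
move=> d2 m0 hA e e0; have [C C0 hC] := fb_envelope_expansion.
set r := gam^-1 *: (x - T x).
pose k := fnorm r * 2 * gam + 1.
have k0 : 0 < k by rewrite ltr_wpDl // !mulr_ge0 ?fnorm_ge0 // ltW.
pose c := e / 2 / k; have c0 : 0 < c by rewrite !divr_gt0.
have [d d0 hd] := differentiable_has_jac d2 c0.
exists (Num.min d (e / 2 / (C + 1))).
  by rewrite lt_min d0 !divr_gt0 // ltr_wpDl.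
move=> v; rewrite le_min => /andP[vd vC].
set y := x + v; have yx : y - x = v by rewrite /y addrAC subrr add0r.
have hn : fnorm (p y - p x) <= fnorm v by rewrite -yx pmap_nonexpansive.
have herr : fnorm (err x y) <= gam * c * fnorm v.
  rewrite -yx; apply: hess_error_norm; first exact: ltW.
  have := hd (p y - p x) (le_trans hn vd).
  by rewrite [p x + _]addrC subrK.
have := hC (p x) (p y); rewrite -!envelopeE -residualE -/r.
rewrite (forward_linearization y m0 hA) yx (fdotDr r) fdotNr.
have -> : fdot r (B (p x) *m v) = fdot (envelope_grad x) v.
  rewrite /envelope_grad scalemxAr fdot_mulmxl.
  by rewrite (damped_resolvent_sym m0 th0 hA).
set E := th *: _ + _.
move: (env y) (env x) (fdot (envelope_grad x) v) => ey ex q h1.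
have hE : fnorm E <= (1 + 1) * (gam * c * fnorm v).
  apply: le_trans (ler_fnormD _ _) _; rewrite fnormZ ger0_norm //.
  have hB := damped_resolvent_norm m0 th0 hA (err x y).
  rewrite mulrDl mul1r lerD // -[leRHS]mul1r.
  by rewrite ler_pM ?fnorm_ge0 // (le_trans hB herr).
have h2 : `|fdot r E| <= e / 2 * fnorm v.
  apply: le_trans (fdot_CS_abs _ _) _.
  apply: le_trans (ler_wpM2l (fnorm_ge0 _) hE) _.
  have -> : fnorm r * ((1 + 1) * (gam * c * fnorm v)) =
      (fnorm r * 2 * gam) * c * fnorm v by ring.
  rewrite ler_wpM2r ?fnorm_ge0 // /c mulrCA -[leRHS]mulr1 ler_wpM2l ?divr_ge0 ?(ltW e0) //.
  by rewrite ler_pdivrMr // mul1r lerDl.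
have h3 : C * fdot (p y - p x) (p y - p x) <= e / 2 * fnorm v.
  rewrite -fnorm_sqr; apply: (@le_trans _ _ (C * fnorm v ^+ 2)).
    by rewrite ler_wpM2l // ler_pXn2r ?nnegrE ?fnorm_ge0.
  rewrite expr2 mulrA ler_wpM2r ?fnorm_ge0 //.
  have Cp : 0 < C + 1 by rewrite ltr_wpDl.
  move: vC; rewrite ler_pdivlMr // mulrC; apply: le_trans.
  by rewrite ler_wpM2r ?fnorm_ge0 // lerDl.
clear herr hE hn vC vd.
move: h1 h2 h3; rewrite !ler_norml => /andP[a1 a2] /andP[b1 b2] c3; apply/andP.
by split; [move: a1|move: a2]; move: b1 b2 c3; dot_lra.
Qed.

Lemma envelope_grad_norm m x : 0 <= m -> form_between m 1 (A (p x)) ->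
  fnorm (envelope_grad x) <= gam^-1 * fnorm (x - T x).
Proof.
move=> m0 hA; have gi0 : 0 <= gam^-1 by rewrite invr_ge0 ltW.
by rewrite fnormZ ger0_norm // ler_wpM2l // (damped_resolvent_norm m0 th0 hA).
Qed.

(** * Lipschitz constant of the envelope gradient *)

Section Regular.
Variables (Om Of : set 'cV[R]_n) (mu H hdg : R).
Hypothesis Om_convex : @convex_set R 'cV[R]_n Om.
Hypothesis Of_convex : @convex_set R 'cV[R]_n Of.
Hypothesis f2 : forall x, differentiable df x.
Hypothesis pOf : forall x, Om x -> Of (p x).
Hypotheses (mu0 : 0 <= mu) (muL : mu <= L) (H0 : 0 <= H).
Hypothesis hess_form : forall y, Of y -> form_between mu L (hess f y).
Hypothesis hess_lipschitz : forall y z v, Of y -> Of z ->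
  fnorm ((hess f y - hess f z) *m v) <= H * fnorm (y - z) * fnorm v.
Hypothesis residual_bound : forall x, Om x ->
  H * fnorm (gam^-1 *: (x - T x)) <= hdg.

Local Notation m := (gam * mu).
Local Notation k := (1 + th * (gam * mu)).

Let m0 : 0 <= m. Proof. by rewrite mulr_ge0 // ltW. Qed.
Let m1 : m <= 1.
Proof. by apply: le_trans (ltW gamL); rewrite ler_wpM2l // ltW. Qed.
Let k1 : 1 <= k. Proof. by rewrite lerDl mulr_ge0. Qed.
Let k0 : 0 < k. Proof. exact: lt_le_trans ltr01 k1. Qed.

Lemma hess_form_between x : Om x -> form_between m 1 (A (p x)).
Proof.
move=> /pOf/hess_form [hs hv]; split; first by rewrite linearZ /= hs.
move=> v; have /andP[h1 h2] := hv v; rewrite -scalemxAl fdotZr -mulrA.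
rewrite ler_wpM2l ?(ltW gam0) //= mul1r.
apply: le_trans (ler_wpM2l (ltW gam0) h2) _.
by rewrite mulrA ler_piMl ?fdot_ge0 // ltW.
Qed.

Lemma hess_error_quadratic x y : Om x -> Om y ->
  fnorm (err x y) <= gam * H * fnorm (y - x) ^+ 2.
Proof.
move=> Ox Oy; rewrite expr2 mulrA -(mulrA gam).
apply: hess_error_norm; first by rewrite mulr_ge0 ?fnorm_ge0.
apply: le_trans (grad_taylor f2 Of_convex H0 hess_lipschitz (pOf Ox) (pOf Oy)) _.
rewrite expr2 mulrA ler_wpM2r ?fnorm_ge0 // ler_wpM2l //.
exact: pmap_nonexpansive.
Qed.

Lemma pmap_contraction x y : Om x -> Om y ->
  fnorm (p y - p x) <= k^-1 * fnorm (y - x).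
Proof.
move=> Ox Oy; rewrite mulrC ler_pdivlMr // mulrC.
apply: pmap_strong_nonexpansive => //.
apply: (grad_strong_monotone f2 Of_convex _ (pOf Ox) (pOf Oy)) => a v Oa.
by have /andP[] := (hess_form Oa).2 v.
Qed.

Lemma residual_secant x y : Om x -> Om y ->
  fnorm (B (p x) *m ((y - T y) - (x - T x)))
    <= (1 - m) / k ^+ 2 * fnorm (y - x) + 3 * (gam * H * fnorm (y - x) ^+ 2).
Proof.
move=> Ox Oy; have hA := hess_form_between Ox.
have herr := hess_error_quadratic Ox Oy.
set h := p y - p x; set q := Q (p y) - Q (p x).
set dv := h - gam *: (df (p y) - df (p x)).
have gen (a b c d : 'cV[R]_n) : (a - b) - (c - d) = (a - c) - (b - d).
  by rewrite !opprD !opprK addrACA.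
have -> : (y - T y) - (x - T x) = h - q by rewrite !residualE gen.
have [J hJ qJ] : exists2 J, form_between 0 1 J & q = J *m dv.
  apply: firm_secant; rewrite /dv scalerBr -gen.
  exact: (prox_firm gam0 gproper glsc gconvex).
(* [E] collects everything that contains [err]. All the matrices have norm at most 1 and [th <= 1],
   so it is bounded by three copies of [err]. *)
set E := B (p x) *m (J *m (th *: (B (p x) *m err x y) + err x y))
  - th *: (B (p x) *m (S (p x) *m err x y)).
have -> : B (p x) *m (h - q) = (B (p x) *m S (p x) - B (p x) *m J *m B (p x))
    *m (y - x) + E.
  rewrite qJ /dv (forward_linearization y m0 hA) /h (pmap_linearization y m0 hA).
  rewrite /E; move: (th *: _ + err x y) => w; move: (err x y) => r.
  move: (B (p x)) (S (p x)) (y - x) => b c v.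
  rewrite !mulmxBr mulmxBl -!scalemxAr !mulmxA.
  by rewrite opprB [X in _ + X]addrC addrACA [X in _ + X]addrC.
apply: le_trans (ler_fnormD _ _) _; apply: lerD.
  exact: (damped_secant_norm m0 m1 th0 hA).
have hB z : fnorm (B (p x) *m z) <= fnorm z := damped_resolvent_norm m0 th0 hA z.
have hS z : fnorm (S (p x) *m z) <= fnorm z := resolvent_norm1 m0 th0 hA z.
have hJn z : fnorm (J *m z) <= fnorm z.
  by rewrite -[leRHS]mul1r form_between_norm.
have hth z : fnorm (th *: z) <= fnorm z.
  by rewrite fnormZ ger0_norm // ler_piMl ?fnorm_ge0.
apply: (@le_trans _ _ (3 * fnorm (err x y))); last by rewrite ler_wpM2l.
rewrite /E; move: (err x y) => r.
apply: le_trans (ler_fnormB _ _) _.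
have e1 := le_trans (hth _) (le_trans (hB _) (hS r)).
have e2 := le_trans (hB _) (le_trans (hJn _) (ler_fnormD (th *: (B (p x) *m r)) r)).
have e3 := le_trans (hth _) (hB r).
clear herr; move: e1 e2 e3; dot_lra.
Qed.

(** Two of the three factors [k^-1] come from the resolvents on either side of the Hessian
    difference, the third from the contraction of [p]. *)
Lemma damped_resolvent_lipschitz x y v : Om x -> Om y ->
  fnorm ((B (p y) - B (p x)) *m v)
    <= (1 + th) * gam * (H * fnorm v) / k ^+ 3 * fnorm (y - x).
Proof.
move=> Ox Oy; have hA := hess_form_between Ox; have hA' := hess_form_between Oy.
rewrite (damped_resolvent_sub m0 m1 th0 hA hA') -scalemxAl fnormZ.
rewrite ger0_norm ?addr_ge0 // -!mulrA ler_wpM2l ?addr_ge0 // -!mulmxA.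
have hS z : fnorm (S (p x) *m z) <= k^-1 * fnorm z.
  by rewrite mulrC ler_pdivlMr // mulrC (resolvent_norm m0 th0 hA).
have hS' z : fnorm (S (p y) *m z) <= k^-1 * fnorm z.
  by rewrite mulrC ler_pdivlMr // mulrC (resolvent_norm m0 th0 hA').
have ki0 : 0 <= k^-1 by rewrite invr_ge0 ltW.
apply: le_trans (hS' _) _; rewrite -scalerBr -scalemxAl fnormZ ger0_norm ?(ltW gam0) //.
rewrite mulrCA ler_wpM2l ?(ltW gam0) //.
have hlip := hess_lipschitz (S (p x) *m v) (pOf Ox) (pOf Oy).
have hp := pmap_contraction Oy Ox.
have h1 : H * fnorm (p x - p y) * fnorm (S (p x) *m v)
    <= H * (k^-1 * fnorm (x - y)) * (k^-1 * fnorm v).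
  apply: ler_pM; rewrite ?mulr_ge0 ?fnorm_ge0 //; first by rewrite ler_wpM2l.
apply: le_trans (ler_wpM2l ki0 (le_trans hlip h1)) _.
rewrite (fnormBC x y) -exprVn; move: (k^-1) (fnorm v) (fnorm (y - x)) => i a b.
by rewrite le_eqVlt; apply/orP; left; apply/eqP; ring.
Qed.

Definition envelope_lipschitz_const :=
  (1 - m) / (gam * k ^+ 2) + (1 + th) * gam * hdg / k ^+ 3.

Lemma envelope_grad_lipschitz x y : Om x -> Om y ->
  fnorm (envelope_grad y - envelope_grad x)
    <= envelope_lipschitz_const * fnorm (y - x).
Proof.
apply: (@lipschitz_of_second_order _ _ Om envelope_grad _ (3 * H)) => //.
move=> {}x {}y Ox Oy; rewrite /envelope_grad -scalerBr.
have gi0 : 0 <= gam^-1 by rewrite invr_ge0 ltW.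
(* The increment of the residual is paired with [B] at [x], the point of linearization in
   [residual_secant]. *)
have telescope (b b' : 'M[R]_n) (r r' : 'cV[R]_n) :
    b' *m r' - b *m r = b *m (r' - r) + (b' - b) *m r'.
  by rewrite mulmxBr mulmxBl [RHS]addrC addrA subrK.
rewrite telescope.
rewrite scalerDr; apply: le_trans (ler_fnormD _ _) _.
have h1 := residual_secant Ox Oy.
have h2 := damped_resolvent_lipschitz (gam^-1 *: (y - T y)) Ox Oy.
have h3 : (1 + th) * gam * (H * fnorm (gam^-1 *: (y - T y))) / k ^+ 3 * fnorm (y - x)
    <= (1 + th) * gam * hdg / k ^+ 3 * fnorm (y - x).
  rewrite ler_wpM2r ?fnorm_ge0 // ler_wpM2r ?invr_ge0 ?exprn_ge0 ?(ltW k0) //.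
  by rewrite ler_wpM2l ?mulr_ge0 ?addr_ge0 ?(ltW gam0) // residual_bound.
rewrite [X in _ + fnorm X]scalemxAr.
apply: le_trans (lerD (lexx _) (le_trans h2 h3)) _.
rewrite fnormZ ger0_norm //.
apply: le_trans (lerD (ler_wpM2l gi0 h1) (lexx _)) _.
rewrite /envelope_lipschitz_const; move: (fnorm (y - x)) => d.
rewrite le_eqVlt; apply/orP; left; apply/eqP; field.
by rewrite !gt_eqF.
Qed.

End Regular.

End Envelope.

(** * Consequences of the regularity hypothesis *)

Section Regularity.
Opaque hess fdot fnorm prox moreau resolvent damped_resolvent.
Context {R : realType} {n : nat}.
Implicit Types x y z v w d : 'cV[R]_n.

Lemma form_between_loewner (mu L : R) (A : 'M[R]_n) :
  loewner_le mu%:M A -> loewner_le A L%:M -> form_between mu L A.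
Proof.
move=> [As hmu] [_ hL]; split.
  apply/(addIr (- mu%:M)); rewrite -[RHS]As linearB /= tr_scalar_mx //.
move=> v; have := hmu v; have := hL v; rewrite !fdot_quadE !mulmxBl.
rewrite !mul_scalar_mx !fdotDr !fdotNr !fdotZr => h1 h2.
by apply/andP; split; move: h1 h2; dot_lra.
Qed.

Lemma quadratic_grad (Q : 'M[R]_n) (f : 'cV[R]_n -> R) :
  quadratic_with_hessian Q f ->
  exists b, forall x, grad f x = Q *m x + b.
Proof.
move=> [Qs [b [c hf]]]; exists b => x; apply: has_grad_gradE.
apply: (@quadratic_has_grad _ _ _ _ _ (2^-1 * fnorm Q)) => y.
have [v ->] : exists v, y = x + v by exists (y - x); rewrite addrC subrK.
rewrite !hf !fdot_quadE !fdot_vecE [x + v - x]addrAC subrr add0r.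
rewrite mulmxDr !fdotDl !fdotDr.
have -> : fdot v (Q *m x) = fdot (Q *m x) v by rewrite fdotC.
have -> : fdot x (Q *m v) = fdot (Q *m x) v by rewrite fdot_mulmxl Qs.
set q := fdot v (Q *m v).
set X := (X in `|X|); have -> : X = 2^-1 * q by rewrite /X; dot_lra.
rewrite normrM ger0_norm ?invr_ge0 // -mulrA ler_wpM2l ?invr_ge0 //.
apply: le_trans (fdot_CS_abs _ _) _.
rewrite mulrC -fnorm_sqr expr2 mulrA ler_wpM2r ?fnorm_ge0 //.
exact: fnorm_mulmx.
Qed.

Transparent hess.
Lemma affine_grad_hess (Q : 'M[R]_n) b (f : 'cV[R]_n -> R) x :
  (forall y, grad f y = Q *m y + b) -> hess f x = Q.
Proof.
move=> hf; apply/matrixP => i j; rewrite mxE.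
have -> : (fun y => grad f y i 0) = (fun y => (Q *m y + b) i 0).
  by apply/funext => y; rewrite hf.
apply: (@derive_val _ _ _ _ _ _ _ (is_derive_expansion _)) => e e0.
exists 1 => // t _; rewrite mulmxDr -scalemxAr.
rewrite (_ : _ - _ - _ = 0) ?normr0 ?mulr_ge0 ?(ltW e0) //.
have -> : Q i j = (Q *m (delta_mx j 0 : 'cV[R]_n)) i 0.
  rewrite mxE (bigD1 j) //= mxE !eqxx mulr1 big1 ?addr0 // => k kj.
  by rewrite mxE (negbTE kj) mulr0.
by rewrite !mxE; ring.
Qed.
Opaque hess.

(** Brings both alternatives to one form. In the first, [gam^-1 *: (x - T x)] is a gradient of [f]
    plus a subgradient of [g], whence [D + G]. In the quadratic one [Of] is the whole space and
    [H = 0]; this is why the last bound concerns a product with [H], the residual itself being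
    possibly unbounded. *)
Lemma regular_onP (s : splitting) (f : 'cV[R]_n -> R) (g : 'cV[R]_n -> \bar R)
    (L gam mu hdg : R) (Om : set 'cV[R]_n) :
  0 < L -> @convex_function R 'cV[R]_n setT f -> smooth L f ->
  eproper g -> lower_semicontinuous g -> econvex g -> 0 < gam ->
  regular_on s f g gam L mu hdg Om ->
  [/\ 0 <= mu, mu <= L, 0 <= hdg &
  exists (Of : set 'cV[R]_n) (H : R), [/\ @convex_set R 'cV[R]_n Of, 0 <= H,
    forall x, Om x -> Of (pmap_of s f gam x),
    forall y, Of y -> form_between mu L (hess f y) &
    (forall y z v, Of y -> Of z ->
      fnorm ((hess f y - hess f z) *m v) <= H * fnorm (y - z) * fnorm v) /\
    (forall x, Om x ->
      H * fnorm (gam^-1 *: (x - split_op s f g gam x)) <= hdg)]].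
Proof.
move=> L0 fc fs gp gl gc gam0 [/andP[mu0 muL]].
case=> [[Of [H [D [G [[H0 D0 G0 ->] [[Ofc pOf gG] [hh hD hl]]]]]]]|[Q [fQ Ql Qu ->]]].
  split=> //; first by rewrite mulr_ge0 ?addr_ge0.
  exists Of, H; split=> //.
  - by move=> x Ox; apply: pOf; exists x.
  - by move=> y /hh[]; exact: form_between_loewner.
  split=> [y z v Oy Oz|x Ox].
    apply: le_trans (opnorm_mulmx _ _) _.
    by rewrite ler_wpM2r ?fnorm_ge0 // hl.
  rewrite ler_wpM2l // (residualE s g L0 fc fs gam0).
  have Op : Of (pmap_of s f gam x) by apply: pOf; exists x.
  set y := pmap_of s f gam x in Op *; set q := prox _ _ _.
  have -> : gam^-1 *: (y - q) = grad f y + gam^-1 *: (y - gam *: grad f y - q).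
    rewrite [y - _ - q]addrAC (scalerBr _ (y - q)) scalerA mulVf ?gt_eqF //.
    by rewrite scale1r [RHS]addrC subrK.
  apply: le_trans (ler_fnormD _ _) _; apply: lerD; first exact: hD.
  exact: prox_lipschitz_bound.
split=> //; have [b hb] := quadratic_grad fQ.
exists setT, 0; split=> //.
  by move=> y _; rewrite (affine_grad_hess _ hb); exact: form_between_loewner.
split=> [y z v _ _|x _]; last by rewrite mul0r.
by rewrite !(affine_grad_hess _ hb) subrr mul0mx fnorm0 !mul0r.
Qed.

End Regularity.

(** * Projection onto a compact convex set of matrices *)

Section Projection.
Opaque hess fdot fnorm prox moreau resolvent damped_resolvent.
Context {R : realType} {n : nat}.
Implicit Types (A : set 'M[R]_n) (P Q Z : 'M[R]_n).

Lemma fnorm_dist_continuous Z : continuous (fun Q : 'M[R]_n => fnorm (Q - Z)).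
Proof.
move=> Q B /= /nbhs_ballP[e /= e0 hB].
pose c : R := (n * n)%:R + 1; have c0 : 0 < c by rewrite ltr_wpDl.
apply/nbhs_ballP; exists (e / c) => [|P]; first exact: divr_gt0.
rewrite -ball_normE /= => hP; apply: hB; rewrite -ball_normE /=.
have h : fnorm (Q - P) < e.
  apply: le_lt_trans (fnorm_le_mx_norm _) _.
  move: hP; rewrite ltr_pdivlMr // mulrC; apply: le_lt_trans.
  by rewrite ler_wpM2r // lerDl.
have h1 := ler_fnorm_dist Q P Z; have h2 := ler_fnorm_dist P Q Z.
rewrite (fnormBC P Q) in h2; rewrite ltr_norml; apply/andP.
by split; move: h h1 h2; dot_lra.
Qed.

Lemma proj_argmin A Z : compact A -> A !=set0 ->
  argmin A (fun Q => fnorm (Q - Z)) (proj A Z).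
Proof.
move=> Ac A0; apply: xgetPex.
have [|P PA hP] := compact_EVT_min A0 Ac (f := fun Q => fnorm (Q - Z)).
  exact/continuous_subspaceT/fnorm_dist_continuous.
exists P; split; first exact: set_mem.
by move=> Q AQ; apply: hP; exact: mem_set.
Qed.

Lemma proj_contraction A Z Q : compact A -> @convex_set R 'M[R]_n A -> A Q ->
  fnorm (proj A Z - Q) <= fnorm (Z - Q).
Proof.
move=> Ac /convex_setP Acvx AQ.
have [AP hP] := @proj_argmin A Z Ac (ex_intro _ Q AQ).
set P := proj A Z in AP hP *; set d := Q - P.
(* First-order optimality of the projection along the segment from [P] to [Q]. *)
have h : 0 <= fdot (P - Z) d.
  apply: (@le_of_small _ _ _ (2^-1 * fdot d d)) => t /andP[t0 t1].
  have := hP _ (Acvx Q P t AQ AP _); rewrite (ltW t0) t1 => /(_ isT).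
  have -> : t *: Q + (1 - t) *: P - Z = (P - Z) + t *: d.
    by rewrite /d scalerBr scalerBl scale1r addrCA addrAC.
  rewrite -(@ler_pXn2r _ 2) ?nnegrE ?fnorm_ge0 // !fnorm_sqr.
  rewrite (fdot_sqrD (P - Z) (t *: d)).
  rewrite !fdotZr fdotZl => h; rewrite -(ler_pM2l t0); move: h; dot_lra.
have PQ : P - Q = - d by rewrite opprB.
have ZQ : Z - Q = - ((P - Z) + d) by rewrite /d [P - Z + _]addrC addrA subrK opprB.
rewrite PQ ZQ !fnormN -(@ler_pXn2r _ 2) ?nnegrE ?fnorm_ge0 // !fnorm_sqr.
have := fdot_ge0 (P - Z); rewrite (fdot_sqrD (P - Z) d); move: h.
by clearbody d; move: (P - Z) => a; dot_lra.
Qed.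

Lemma fnorm_le_diam A P Q : compact A -> A P -> A Q -> fnorm (P - Q) <= diam A.
Proof.
move=> Ac AP AQ; apply: ub_le_sup; last by exists P, Q.
have /ex_strict_bound_gt0[b b0 hb] := compact_bounded Ac.
exists ((n * n)%:R * (b + b)) => _ [P' [Q' [AP' AQ' ->]]].
apply: le_trans (fnorm_le_mx_norm _) _; rewrite ler_wpM2l //.
apply: le_trans (ler_normB _ _) _.
by rewrite lerD // ltW //; apply: hb.
Qed.

End Projection.

(** * Online scaling *)

Section OnlineScaling.
Opaque hess fdot fnorm prox moreau resolvent damped_resolvent.
Context {R : realType} {n : nat}.
Implicit Types (x y z v : 'cV[R]_n) (P Q : 'M[R]_n).

Lemma leif_AGM_ord (E : nat -> R) j : (forall i, (i < j)%N -> 0 <= E i) ->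
  \prod_(i < j) E i <= ((\sum_(i < j) E i) / j%:R) ^+ j.
Proof.
move=> E0; have [|+ _] := @leif_AGM R 'I_j predT (fun i => E i).
  by move=> i _; exact: E0.
by rewrite card_ord.
Qed.

Variables (F : 'cV[R]_n -> R) (r GF : 'cV[R]_n -> 'cV[R]_n).

(** [F], [r] and [GF] stand for the envelope, the residual [x - T x] and the envelope gradient. The
    online analysis sees the splitting only through the hypotheses below, and this definition
    unfolds to [feedback]. *)
Definition step_loss x P := (F (x - P *m r x) - F x) / fnorm (r x) ^+ 2.

Lemma step_loss_grad x P : has_grad F (x - P *m r x) (GF (x - P *m r x)) ->
  grad (step_loss x) P =
  - (fnorm (r x) ^+ 2)^-1 *: (GF (x - P *m r x) *m (r x)^T).
Proof.
set y := x - P *m r x; set q := (fnorm (r x) ^+ 2)^-1 => hG.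
have q0 : 0 <= q by rewrite invr_ge0 sqr_ge0.
apply/matrixP => i j; rewrite mxE.
apply: (@derive_val _ _ _ _ _ _ _ (is_derive_expansion _)) => e e0.
pose d : 'cV[R]_n := - (delta_mx i j *m r x).
have q1 : 0 < q + 1 by rewrite ltr_wpDl.
have [s s0 hs] := has_grad_along d hG (divr_gt0 e0 q1).
exists s => // t ts; rewrite /step_loss -/q.
have -> : x - (P + t *: delta_mx i j) *m r x = y + t *: d.
  by rewrite /y /d mulmxDl opprD addrA -scalemxAl scalerN.
have -> : (- q *: (GF y *m (r x)^T)) i j = q * fdot (GF y) d.
  by rewrite /d fdotNr -fdot_outer fdot_delta [LHS]mxE mulNr mulrN.
have -> : (F (y + t *: d) - F x) * q - (F y - F x) * q - t * (q * fdot (GF y) d)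
    = q * (F (y + t *: d) - F y - t * fdot (GF y) d) by ring.
rewrite normrM ger0_norm //.
apply: le_trans (ler_wpM2l q0 (hs t ts)) _.
rewrite mulrA ler_wpM2r // mulrCA ler_piMr ?(ltW e0) //.
by rewrite ler_pdivrMr // mul1r lerDl.
Qed.

Variables (cP : set 'M[R]_n) (x0 xs : 'cV[R]_n) (M : 'M[R]_n) (rho c gi G mug : R).
Hypothesis F_convex : @convex_function R 'cV[R]_n setT F.
Hypothesis F_min : forall x, F xs <= F x.
Hypotheses (c0 : 0 < c) (gi0 : 0 < gi) (G0 : 0 < G) (rho0 : 0 < rho) (mug0 : 0 < mug).
Hypothesis grad_step : forall x P, F x <= F x0 -> cP P ->
  has_grad F (x - P *m r x) (GF (x - P *m r x)) /\
  fnorm (GF (x - P *m r x)) <= G * fnorm (r x).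
Hypothesis grad_point : forall x, F x <= F x0 ->
  has_grad F x (GF x) /\ fnorm (GF x) <= gi * fnorm (r x).
Hypothesis decrease : forall x, F (x - r x) <= F x - c * fdot (r x) (r x).
Hypothesis local_affine : forall x, eball xs rho x -> r x = (1%:M - M) *m (x - xs).
Hypothesis M_unit : 1%:M - M \in unitmx.
Hypothesis F_strong : strongly_convex_on mug (eball xs rho) F.
Hypotheses (cP_compact : compact cP) (cP_convex : @convex_set R 'M[R]_n cP).
Hypotheses (cP1 : cP 1%:M) (cPM : cP (invmx (1%:M - M))).

Local Notation Delta := (diam cP).
Local Notation ell := step_loss.

(** Strong convexity on the segment from [xs], where [F] is at least [F xs]; after division by [t],
    the limit at 0 gives the full factor [mug / 2]. *)
Lemma growth_in_ball x : eball xs rho x ->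
  mug / 2 * fnorm (x - xs) ^+ 2 <= F x - F xs.
Proof.
move=> Bx; have Bxs : eball xs rho xs by rewrite /eball /= subrr fnorm0 ltW.
set d := x - xs; rewrite fnorm_sqr.
apply: (@le_of_small _ _ _ (mug / 2 * fdot d d)) => t /andP[t0 t1].
have /convex_functionP/(_ x xs t Bx Bxs) := F_strong.
rewrite (ltW t0) t1 => /(_ isT).
have -> : t *: x + (1 - t) *: xs = xs + t *: d.
  by rewrite /d scalerBr scalerBl scale1r addrCA.
have := F_min (xs + t *: d).
have xE : x = xs + d by rewrite /d addrC subrK.
clearbody d; rewrite xE !fnorm_sqr !fdot_sqrD !fdotZr fdotZl => h1 h2.
rewrite -(ler_pM2l t0); move: h1 h2.
move: (F _) (F (xs + d)) (F xs) => a b e; dot_lra.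
Qed.

(** The quadratic growth at the point [z] where the segment from [xs] to [x] leaves the ball is
    propagated linearly by global convexity. *)
Lemma growth_off_ball x : ~ eball xs rho x ->
  mug * rho / 2 * fnorm (x - xs) <= F x - F xs.
Proof.
move=> /negP; rewrite -ltNge => hx; have dx := lt_trans rho0 hx.
set d := fnorm (x - xs) in hx dx *.
pose t := rho / d; have t0 : 0 < t by rewrite divr_gt0.
have t1 : t <= 1 by rewrite ler_pdivrMr // mul1r ltW.
pose z := t *: x + (1 - t) *: xs.
have zE : z - xs = t *: (x - xs).
  by rewrite /z scalerBr scalerBl scale1r -addrA addrAC subrr add0r.
have nz : fnorm (z - xs) = rho.
  by rewrite zE fnormZ ger0_norm ?(ltW t0) // -/d /t divfK // gt_eqF.
have := @growth_in_ball z; rewrite /eball /= nz => /(_ (lexx _)) h1.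
have /convex_functionP/(_ x xs t I I) := F_convex.
rewrite (ltW t0) t1 -/z => /(_ isT) h2.
rewrite -(ler_pM2l t0) (_ : t * _ = mug / 2 * rho ^+ 2).
  by move: h1 h2; lra.
by rewrite /t; field; rewrite gt_eqF.
Qed.

(** * Regret of projected online gradient descent *)

Section Run.
Variables (K : nat) (x : nat -> 'cV[R]_n) (P : nat -> 'M[R]_n).
Local Notation eta := (Delta / (G * Num.sqrt K%:R)).
Hypotheses (x_0 : x 0%N = x0) (P_0 : P 0%N = 1%:M) (K_gt0 : (0 < K)%N).
Hypothesis r_neq0 : forall k, (k < K)%N -> r (x k) != 0.
Hypothesis P_step : forall k, (k < K)%N ->
  P k.+1 = proj cP (P k - eta *: grad (ell (x k)) (P k)).
Hypothesis x_step : forall k, (k < K)%N ->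
  argmin [set x k; x k - P k *m r (x k)] F (x k.+1).

Lemma P_mem k : (k <= K)%N -> cP (P k).
Proof.
case: k => [_|k kK]; first by rewrite P_0.
by rewrite P_step //; apply: (proj_argmin _ cP_compact _).1; exists 1%:M.
Qed.

Lemma F_step k : (k < K)%N ->
  F (x k.+1) <= F (x k) /\ F (x k.+1) <= F (x k - P k *m r (x k)).
Proof. by move=> /x_step [_ h]; split; apply: h; [left|right]. Qed.

Lemma F_le_start k : (k <= K)%N -> F (x k) <= F x0.
Proof.
elim: k => [_|k ih kK]; first by rewrite x_0.
exact: le_trans (F_step kK).1 (ih (ltnW kK)).
Qed.

Lemma F_antitone j k : (j <= k)%N -> (k <= K)%N -> F (x k) <= F (x j).
Proof.
elim: k => [|k ih]; first by rewrite leqn0 => /eqP ->.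
rewrite leq_eqVlt => /predU1P[-> //|jk kK].
exact: le_trans (F_step kK).1 (ih jk (ltnW kK)).
Qed.

Definition regret Q k := ell (x k) (P k) - ell (x k) Q.

(** The loss is convex in [P], being convex in an affine function of [P]. Its gradient is at most
    [G] in norm: the outer product contributes one factor [fnorm (r (x k))], the gradient bound
    another, and the normalization cancels both. *)
Lemma regret_step Q k : cP Q -> (k < K)%N ->
  2 * eta * regret Q k <=
  fnorm (P k - Q) ^+ 2 - fnorm (P k.+1 - Q) ^+ 2 + (eta * G) ^+ 2.
Proof.
move=> cQ kK; have Fk := F_le_start (ltnW kK).
have [hG nG] := grad_step Fk (P_mem (ltnW kK)).
have eta0 : 0 <= eta.
  rewrite divr_ge0 ?mulr_ge0 ?(ltW G0) ?sqrtr_ge0 //.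
  exact: le_trans (fnorm_ge0 _) (fnorm_le_diam cP_compact cQ cQ).
have rn : 0 < fnorm (r (x k)) ^+ 2 by rewrite exprn_gt0 // fnorm_gt0 ?r_neq0.
have := proj_contraction (P k - eta *: grad (ell (x k)) (P k)) cP_compact cP_convex cQ.
rewrite -P_step // (step_loss_grad hG).
set y := x k - P k *m r (x k) in hG nG *; set q := (fnorm (r (x k)) ^+ 2)^-1.
set g := - q *: _ => hP.
have q0 : 0 <= q by rewrite invr_ge0 ltW.
have gn : fnorm g <= G.
  rewrite /g fnormZ normrN ger0_norm // fnorm_outer /q mulrC ler_pdivrMr //.
  by rewrite expr2 mulrA ler_wpM2r ?fnorm_ge0.
have hreg : regret Q k <= fdot g (P k - Q).
  have := convex_has_grad (x k - Q *m r (x k)) F_convex hG.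
  have -> : x k - Q *m r (x k) - y = (P k - Q) *m r (x k).
    by rewrite /y mulmxBl opprB addrC addrA subrK.
  rewrite /g fdotZl fdot_outer mulNr /regret /step_loss -/y -/q -mulrBl => h.
  by rewrite mulrC -mulrN ler_wpM2l //; move: h; dot_lra.
have h1 : fnorm (P k.+1 - Q) ^+ 2 <= fdot ((P k - Q) - eta *: g) ((P k - Q) - eta *: g).
  rewrite -fnorm_sqr ler_pXn2r ?nnegrE ?fnorm_ge0 //.
  by rewrite [P k - Q - _]addrAC.
have h2 : eta ^+ 2 * fdot g g <= (eta * G) ^+ 2.
  rewrite [(eta * G) ^+ 2]exprMn ler_wpM2l ?sqr_ge0 // -fnorm_sqr.
  by rewrite ler_pXn2r ?nnegrE ?fnorm_ge0 ?(ltW G0).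
have h3 := ler_wpM2l eta0 hreg.
clear hP gn hreg q0 rn; clearbody g.
move: h1 h2 h3; rewrite fdot_sqrB !fdotZr fdotZl (fdotC _ g) !fnorm_sqr.
by move: eta (regret Q k) => e l; dot_lra.
Qed.

Let Delta_ge0 : 0 <= Delta.
Proof. exact: le_trans (fnorm_ge0 _) (fnorm_le_diam cP_compact cP1 cP1). Qed.

(** The telescoping sum sees only the distance from [P a] to [Q], at most [Delta] wherever the
    window starts; a window shorter than [K] only reduces the second term. *)
Lemma regret_sum Q a j : cP Q -> (a + j <= K)%N ->
  \sum_(i < j) regret Q (a + i) <= Delta * G * Num.sqrt K%:R.
Proof.
move=> cQ ajK.
have K0 : 0 < K%:R :> R by rewrite ltr0n.
have sK : 0 < Num.sqrt K%:R :> R by rewrite sqrtr_gt0.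
(* The step size vanishes when [Delta = 0], so it cannot be divided out; but then [cP] is a single
   point and every regret is 0. *)
have [D0|D0] := eqVneq Delta 0.
  rewrite D0 !mul0r big1 // => i _.
  have -> : Q = P (a + i).
    apply/eqP; rewrite -subr_eq0; apply/eqP/fnorm_eq0/eqP; rewrite eq_le fnorm_ge0.
    rewrite andbT -D0; apply: fnorm_le_diam => //; apply: P_mem.
    by rewrite (leq_trans _ ajK) // leq_add2l ltnW.
  by rewrite /regret subrr.
have Dp : 0 < Delta by rewrite lt_neqAle eq_sym D0.
have ep : 0 < eta by rewrite divr_gt0 // mulr_gt0.
have telescope : 2 * eta * \sum_(i < j) regret Q (a + i) <=
    fnorm (P a - Q) ^+ 2 - fnorm (P (a + j) - Q) ^+ 2 + j%:R * (eta * G) ^+ 2.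
  elim: j ajK => [_|j ih ajK].
    by rewrite big_ord0 mulr0 addn0 subrr mul0r addr0.
  rewrite addnS in ajK *; rewrite big_ord_recr /= mulrDr.
  rewrite (_ : j.+1%:R = j%:R + 1 :> R); last by rewrite natr1.
  have := regret_step cQ ajK; have := ih (ltnW ajK).
  move: ((eta * G) ^+ 2) (2 * eta) => e t.
  move: (\sum_(_ < _) _) (regret _ _) j%:R => u v w; dot_lra.
have hD : fnorm (P a - Q) ^+ 2 <= Delta ^+ 2.
  rewrite ler_pXn2r ?nnegrE ?fnorm_ge0 //.
  by apply: fnorm_le_diam => //; apply: P_mem; exact: leq_trans (leq_addr j a) ajK.
have hj : j%:R * (eta * G) ^+ 2 <= Delta ^+ 2.
  have -> : (eta * G) ^+ 2 = Delta ^+ 2 / K%:R.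
    rewrite (_ : eta * G = Delta / Num.sqrt K%:R).
      by rewrite expr_div_n sqr_sqrtr // ltW.
    by field; rewrite !gt_eqF.
  rewrite mulrCA ler_piMr ?sqr_ge0 // ler_pdivrMr // mul1r ler_nat.
  exact: leq_trans (leq_addl a j) ajK.
have hs : 2 * eta * \sum_(i < j) regret Q (a + i) <= 2 * Delta ^+ 2.
  apply: le_trans telescope _.
  have := sqr_ge0 (fnorm (P (a + j) - Q)); move: hD hj; move: (_ * (eta * G) ^+ 2).
  by move=> u; dot_lra.
have e2 : 0 < 2 * eta by rewrite mulr_gt0.
rewrite -(ler_pM2l e2); apply: le_trans hs _.
rewrite le_eqVlt; apply/orP; left; apply/eqP.
by field; rewrite !gt_eqF.
Qed.

(** * Local rate inside the ball *)

Local Notation B := (eball xs rho).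
Local Notation kappa := (2 * opnorm (1%:M - M) ^+ 2 / mug).
Local Notation Mi := (invmx (1%:M - M)).

Lemma newton_step k : B (x k) -> x k - Mi *m r (x k) = xs.
Proof.
by move=> Bk; rewrite local_affine // mulmxA mulVmx // mul1mx opprB addrC subrK.
Qed.

Lemma regret_local k : B (x k) -> (k < K)%N ->
  regret Mi k * fnorm (r (x k)) ^+ 2 = F (x k - P k *m r (x k)) - F xs.
Proof.
move=> Bk kK; rewrite /regret /step_loss newton_step // -mulrBl divfK.
  by rewrite opprB addrA subrK.
by rewrite sqrf_eq0 gt_eqF // fnorm_gt0 // r_neq0.
Qed.

Lemma regret_local_ge0 k : B (x k) -> (k < K)%N -> 0 <= regret Mi k.
Proof.
move=> Bk kK.
have rn : 0 < fnorm (r (x k)) ^+ 2 by rewrite exprn_gt0 // fnorm_gt0 // r_neq0.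
by rewrite -(pmulr_lge0 _ rn) regret_local // subr_ge0.
Qed.

(** The new gap is at most [regret Mi k * fnorm (r (x k)) ^+ 2], since the comparison step lands on
    [xs]. Quadratic growth bounds the gap below by the new squared distance, and
    [r = (I - M) (x - xs)] bounds the residual above. *)
Lemma local_contraction k : B (x k) -> B (x k.+1) -> (k < K)%N ->
  fnorm (x k.+1 - xs) ^+ 2 <= kappa * regret Mi k * fnorm (x k - xs) ^+ 2.
Proof.
move=> Bk Bk1 kK.
have h1 := growth_in_ball Bk1.
have h2 := (F_step kK).2.
have h3 : fnorm (r (x k)) ^+ 2 <= opnorm (1%:M - M) ^+ 2 * fnorm (x k - xs) ^+ 2.
  rewrite -exprMn ler_pXn2r ?nnegrE ?mulr_ge0 ?opnorm_ge0 ?fnorm_ge0 //.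
  by rewrite local_affine // opnorm_mulmx.
have h4 := ler_wpM2l (regret_local_ge0 Bk kK) h3.
rewrite regret_local // in h4.
have m2 : 0 < mug / 2 by rewrite divr_gt0.
rewrite -(ler_pM2l m2); apply: le_trans h1 _.
have -> : mug / 2 * (kappa * regret Mi k * fnorm (x k - xs) ^+ 2) =
    regret Mi k * (opnorm (1%:M - M) ^+ 2 * fnorm (x k - xs) ^+ 2).
  by field; rewrite gt_eqF.
by apply: le_trans h4; rewrite lerD2r.
Qed.

Lemma local_rate a j : (forall k, (a <= k <= a + j)%N -> B (x k)) ->
  (a + j <= K)%N ->
  fnorm (x (a + j)%N - xs) ^+ 2 <= fnorm (x a - xs) ^+ 2 *
    (kappa * (Delta * G * Num.sqrt K%:R / j%:R)) ^+ j.
Proof.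
move=> hB ajK.
have kap0 : 0 <= kappa.
  by apply: divr_ge0; [rewrite mulr_ge0 ?sqr_ge0|exact: ltW].
have reg0 i : (i < j)%N -> 0 <= regret Mi (a + i).
  move=> ij; apply: regret_local_ge0.
    by apply: hB; rewrite leq_addr leq_add2l ltnW.
  by apply: leq_trans ajK; rewrite ltn_add2l.
have prod_bound l : (l <= j)%N -> fnorm (x (a + l)%N - xs) ^+ 2 <=
    fnorm (x a - xs) ^+ 2 * (kappa ^+ l * \prod_(i < l) regret Mi (a + i)).
  elim: l => [_|l ih lj]; first by rewrite addn0 big_ord0 expr0 !mulr1.
  rewrite addnS big_ord_recr /=.
  have alK : (a + l < K)%N by apply: leq_trans ajK; rewrite ltn_add2l.
  have Bl : B (x (a + l)%N) by apply: hB; rewrite leq_addr leq_add2l ltnW.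
  have Bl1 : B (x (a + l).+1).
    by apply: hB; rewrite -addnS leq_addr leq_add2l.
  apply: le_trans (local_contraction Bl Bl1 alK) _.
  have hr := reg0 _ lj.
  apply: le_trans (ler_wpM2l (mulr_ge0 kap0 hr) (ih (ltnW lj))) _.
  rewrite le_eqVlt; apply/orP; left; apply/eqP.
  rewrite [kappa ^+ l.+1]exprS.
  by move: (kappa ^+ l) => kl; move: kappa => ka; ring.
apply: le_trans (prod_bound j (leqnn j)) _.
rewrite ler_wpM2l ?sqr_ge0 // [(kappa * _) ^+ j]exprMn ler_wpM2l ?exprn_ge0 //.
apply: le_trans (leif_AGM_ord reg0) _.
have s0 : 0 <= \sum_(i < j) regret Mi (a + i) by apply: sumr_ge0 => i _; exact: reg0.
have dj : 0 <= j%:R^-1 :> R by rewrite invr_ge0.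
by rewrite lerXn2r ?nnegrE ?mulr_ge0 ?sqrtr_ge0 ?(ltW G0) // ler_wpM2r // regret_sum.
Qed.

(** * Bound on the last exit from the ball *)

Definition escape_radius := rho + 2 * (F x0 - F xs) / (mug * rho).
(** Outside the ball the gap is at least [mug * rho ^+ 2 / 2], while convexity bounds any gap by
    [gi * fnorm (r x)] times the distance to [xs]. On the initial sublevel set that distance is at
    most [escape_radius], by linear growth off the ball. *)
Definition escape_residual := mug * rho ^+ 2 / 2 / (gi * escape_radius).

Lemma escape_radius_gt0 : 0 < escape_radius.
Proof.
by rewrite ltr_wpDr // divr_ge0 ?mulr_ge0 ?subr_ge0 ?F_min // ltW.
Qed.

Lemma escape_residual_gt0 : 0 < escape_residual.
Proof.
by rewrite divr_gt0 // ?mulr_gt0 ?exprn_gt0 // escape_radius_gt0.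
Qed.

(** The iterate [x k] may itself lie in the ball: the gap is taken from the later iterate [x m] and
    carried back by monotonicity of the values. *)
Lemma escape_residual_le k m : (k <= m)%N -> (m <= K)%N -> ~ B (x m) ->
  escape_residual <= fnorm (r (x k)).
Proof.
move=> km mK nB; have kK := leq_trans km mK.
have e0 := escape_radius_gt0.
have mr : 0 < mug * rho by rewrite mulr_gt0.
have Fk := F_le_start kK.
have rad : fnorm (x k - xs) <= escape_radius.
  have [Bk|/growth_off_ball h] := pselect (B (x k)).
    apply: le_trans Bk _; by rewrite lerDl divr_ge0 ?mulr_ge0 ?subr_ge0 ?F_min // ltW.
  apply: (@le_trans _ _ (2 * (F x0 - F xs) / (mug * rho))); last first.
    by rewrite lerDr ltW.
  rewrite ler_pdivlMr //; move: h Fk; move: (F _) (F x0) (F xs); dot_lra.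
have gap : mug * rho ^+ 2 / 2 <= F (x k) - F xs.
  have h1 := growth_off_ball nB; have h2 := F_antitone km mK.
  have h3 : rho <= fnorm (x m - xs).
    by move/negP : nB; rewrite -ltNge => /ltW.
  have mr2 : 0 <= mug * rho / 2 by rewrite divr_ge0 // ltW.
  have h4 := ler_wpM2l mr2 h3.
  apply: (@le_trans _ _ (F (x m) - F xs)); last by rewrite lerD2r.
  by apply: le_trans h1; apply: le_trans h4; rewrite expr2; lra.
have [hG nG] := grad_point Fk.
have h1 := convex_has_grad xs F_convex hG.
have h2 := fdot_CS (- GF (x k)) (xs - x k).
rewrite fnormN fdotNl (fnormBC xs) in h2.
rewrite /escape_residual ler_pdivrMr ?mulr_gt0 //.
apply: le_trans gap _; apply: (@le_trans _ _ (fnorm (GF (x k)) * fnorm (x k - xs))).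
  by move: h1 h2; move: (F _) (F xs); dot_lra.
rewrite mulrA [fnorm (r _) * _]mulrC.
by apply: ler_pM => //; exact: fnorm_ge0.
Qed.

Lemma escape_time m : (m <= K)%N -> ~ B (x m) ->
  c * m%:R <= (F x0 - F xs) / escape_residual ^+ 2 + Delta * G * Num.sqrt K%:R.
Proof.
move=> mK nB; set e := escape_residual.
have e2 : 0 < e ^+ 2 by rewrite exprn_gt0 // escape_residual_gt0.
have dec k : (k < m)%N -> e ^+ 2 * (c - regret 1%:M k) <= F (x k) - F (x k.+1).
  move=> km; have kK := leq_trans km mK.
  have rn : 0 < fnorm (r (x k)) ^+ 2 by rewrite exprn_gt0 // fnorm_gt0 // r_neq0.
  have [h1 h2] := F_step kK.
  have h3 : e ^+ 2 <= fnorm (r (x k)) ^+ 2.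
    rewrite ler_pXn2r ?nnegrE ?fnorm_ge0 ?(ltW escape_residual_gt0) //.
    exact: escape_residual_le (ltnW km) mK nB.
  have h4 : (c - regret 1%:M k) * fnorm (r (x k)) ^+ 2 <= F (x k) - F (x k.+1).
    have hr : regret 1%:M k * fnorm (r (x k)) ^+ 2 =
        F (x k - P k *m r (x k)) - F (x k - r (x k)).
      rewrite /regret /step_loss mul1mx -mulrBl divfK ?gt_eqF //.
      by rewrite opprB addrA subrK.
    rewrite mulrBl hr.
    have := decrease (x k); rewrite -fnorm_sqr; move: h2.
    by move: (F _) (F (x k - r (x k))) (F (x k)) (F (x k.+1)) => a b d l; dot_lra.
  (* A negative factor reverses the residual lower bound; then the monotonicity of [F] along the run
     is enough. *)
  have [cr|cr] := leP 0 (c - regret 1%:M k).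
    by apply: le_trans h4; rewrite mulrC ler_wpM2l.
  apply: (@le_trans _ _ 0); last by rewrite subr_ge0.
  by rewrite mulr_ge0_le0 ?ltW.
have sum l : (l <= m)%N ->
    e ^+ 2 * (c * l%:R - \sum_(i < l) regret 1%:M (0 + i)) <= F x0 - F (x l).
  elim: l => [_|l ih lm].
    by rewrite big_ord0 mulr0 subrr mulr0 x_0 subrr.
  rewrite big_ord_recr /= add0n (_ : l.+1%:R = l%:R + 1 :> R); last by rewrite natr1.
  have := dec l lm; have := ih (ltnW lm).
  by move: (F _) (F x0) (F (x l)) (regret _ _) (\sum_(_ < _) _) => a b d t u; lra.
have := sum m (leqnn m); have := regret_sum cP1 (_ : (0 + m <= K)%N).
rewrite add0n => /(_ mK) h1 h2.
have h3 : e ^+ 2 * (c * m%:R - \sum_(i < m) regret 1%:M (0 + i)) <= F x0 - F xs.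
  by apply: le_trans h2 _; rewrite lerD2l lerN2.
rewrite mulrC -ler_pdivlMr // in h3.
by rewrite lerBlDr in h3; apply: le_trans h3 _; rewrite lerD2l.
Qed.

End Run.
End OnlineScaling.

(** Minimality of [k] can fail at [k.-1] only through the iterate [k.-1] itself. The default value
    [K.+1] is covered: the first part is then vacuous and the second says that [x K] lies
    outside. *)
Lemma ident_indexP {R : realType} {n : nat} (B : set 'cV[R]_n) K x
    (k := ident_index B K x) :
  (forall j, (k <= j <= K)%N -> B (x j)) /\
  ((0 < k)%N -> (k.-1 <= K)%N /\ ~ B (x k.-1)).
Proof.
pose p i := `[< forall j, (i <= j <= K)%N -> B (x j) >].
have kE : k = find p (iota 0 K.+1) by [].
have ksz : (k <= K.+1)%N by rewrite kE -[X in (_ <= X)%N](size_iota 0) find_size.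
have hk j : (k <= j <= K)%N -> B (x j).
  move=> /andP[kj jK]; have kK : (k < K.+1)%N by rewrite ltnS (leq_trans kj).
  have : p (nth 0%N (iota 0 K.+1) k).
    by rewrite kE nth_find // has_find size_iota -kE.
  by rewrite nth_iota // add0n => /asboolP; apply; rewrite kj.
split=> // k0; have kK : (k.-1 < K.+1)%N by rewrite prednK.
split=> // Bk; have : ~~ p k.-1.
  have := @before_find _ 0%N p (iota 0 K.+1) k.-1.
  by rewrite -kE prednK // leqnn nth_iota // add0n => /(_ isT) ->.
move/asboolP; apply => j /andP[]; rewrite leq_eqVlt => /predU1P[<- //|].
by rewrite prednK // => kj jK; apply: hk; rewrite kj.
Qed.

Opaque hess fdot fnorm prox moreau resolvent damped_resolvent.

Lemma envelope_constE {R : realType} (s : splitting) (gam mu hdg : R) :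
  envelope_const s gam mu hdg = envelope_lipschitz_const s gam mu hdg.
Proof.
rewrite /envelope_const /envelope_lipschitz_const; case: s => /=.
  by rewrite !mul0r !addr0 !expr1n !mulr1 !divr1 mul1r.
by rewrite !mul1r.
Qed.

(** * Verification of the abstract hypotheses for the envelope *)

Theorem theorem4p24
    (R : realType) (n : nat) (s : splitting)
    (f : 'cV[R]_n -> R) (g : 'cV[R]_n -> \bar R) (L gam : R)
    (x0 : 'cV[R]_n) (cP : set 'M[R]_n) (mu hdg : R)
    (xstar : 'cV[R]_n) (rho : R) (M : 'M[R]_n) (mu_gam : R) :
  0 < L ->
  @convex_function R 'cV[R]_n setT f ->
  twice_differentiable f ->
  smooth L f ->
  eproper g -> lower_semicontinuous g -> econvex g ->
  0 < gam < L^-1 ->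
  regular_on s f g gam L mu hdg (region s f g gam x0 cP) ->
  compact cP -> @convex_set R 'M[R]_n cP -> cP 1%:M ->
  (forall a : R, bounded_set [set x | ((f x)%:E + g x <= a%:E)%E]) ->
  0 < rho ->
  (forall x, eball xstar rho x ->
     split_op s f g gam x = xstar + M *m (x - xstar)) ->
  1%:M - M \in unitmx -> cP (invmx (1%:M - M)) ->
  @convex_function R 'cV[R]_n setT (envelope s f g gam) ->
  0 < mu_gam ->
  strongly_convex_on mu_gam (eball xstar rho) (envelope s f g gam) ->
  let L_gam := envelope_const s gam mu hdg in
  let G_ell := gam^-1 + L_gam + L_gam * diam cP in
  exists C C' : R,
    forall (K : nat) (x : nat -> 'cV[R]_n) (P : nat -> 'M[R]_n),
      (1 <= K)%N ->
      osop_run s f g gam x0 cP (diam cP / (G_ell * Num.sqrt K%:R)) K x P ->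
      let K0 := ident_index (eball xstar rho) K x in
      K0%:R <= C * Num.sqrt K%:R + C' /\
      ((K0 < K)%N ->
       fnorm (x K - xstar) ^+ 2 <=
       fnorm (x K0 - xstar) ^+ 2 *
       (2 * opnorm (1%:M - M) ^+ 2 / mu_gam *
        (diam cP * G_ell * Num.sqrt K%:R / (K - K0)%:R)) ^+ (K - K0)).
Proof.
move=> L0 fc [_ f2] fs gp gl gc /andP[gam0 gamLi] reg cPc cPx cP1 _ rho0 Tlin.
move=> Mu cPM Fc mug0 Fs.
have gamL : gam * L < 1 by rewrite -ltr_pdivlMr // div1r.
have [mu0 muL hdg0 [Of [H [Ofc H0 pOf hform [hlip hres]]]]] :=
  regular_onP L0 fc fs gp gl gc gam0 reg.
set F := envelope s f g gam in Fc Fs *.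
pose r (z : 'cV[R]_n) : 'cV[R]_n := z - split_op s f g gam z.
pose GF := envelope_grad s f g gam.
set Om := region s f g gam x0 cP in reg pOf hres.
move=> Lg Gl; set D := diam cP in Gl *.
have D0 : 0 <= D.
  exact: le_trans (fnorm_ge0 _) (fnorm_le_diam cPc cP1 cP1).
have m0 : 0 <= gam * mu by rewrite mulr_ge0 // ltW.
have Lg0 : 0 <= Lg.
  have m1 : gam * mu <= 1.
    by apply: le_trans (ltW gamL); rewrite ler_wpM2l // ltW.
  have th0 : 0 <= relax s :> R by case: (s).
  rewrite /Lg envelope_constE /envelope_lipschitz_const.
  have k0 : 0 <= 1 + relax s * (gam * mu) by rewrite addr_ge0 // mulr_ge0.
  rewrite addr_ge0 // divr_ge0 ?subr_ge0 ?exprn_ge0 //.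
    by rewrite mulr_ge0 ?exprn_ge0 // ltW.
  by rewrite !mulr_ge0 ?addr_ge0 // ltW.
have Gl0 : 0 < Gl.
  by rewrite /Gl -addrA ltr_pwDl ?invr_gt0 // addr_ge0 ?mulr_ge0.
have Omc : @convex_set R 'cV[R]_n Om by exact: convex_hull_convex.
have OmL z : F z <= F x0 -> Om z by move=> Fz; apply: convex_hull_sub; left.
have OmS z P : F z <= F x0 -> cP P -> Om (z - P *m r z).
  by move=> Fz PP; apply: convex_hull_sub; right; exists z, P.
have hA z : Om z -> form_between (gam * mu) 1 (gam *: hess f (pmap_of s f gam z)).
  exact: (hess_form_between gam0 gamL pOf hform).
have hG z : Om z -> has_grad F z (GF z).
  by move=> Oz; exact: (envelope_has_grad L0 fc fs gp gl gc gam0 (f2 _) m0 (hA z Oz)).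
have nG z : Om z -> fnorm (GF z) <= gam^-1 * fnorm (r z).
  by move=> Oz; exact: (envelope_grad_norm g gam0 m0 (hA z Oz)).
have grad_step z P : F z <= F x0 -> cP P ->
    has_grad F (z - P *m r z) (GF (z - P *m r z)) /\
    fnorm (GF (z - P *m r z)) <= Gl * fnorm (r z).
  move=> Fz PP; have Oy := OmS z P Fz PP; split; first exact: hG.
  have Oz := OmL z Fz; have h1 := nG z Oz.
  have [y yE] : exists y, y = z - P *m r z by eexists.
  rewrite -yE in Oy *.
  (* The region is a convex hull containing both [z] and the trial point [y], so the Lipschitz bound
     applies between them. *)
  have h2 : fnorm (GF y - GF z) <= Lg * fnorm (P *m r z).
    rewrite /Lg envelope_constE.
    have -> : fnorm (P *m r z) = fnorm (y - z).
      by rewrite yE addrAC subrr add0r fnormN.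
    exact: (envelope_grad_lipschitz L0 fc fs gp gl gc gam0 gamL
      Omc Ofc f2 pOf mu0 muL H0 hform hlip hres Oz Oy).
  have h3 : fnorm (P *m r z) <= (1 + D) * fnorm (r z).
    have -> : P *m r z = r z + (P - 1%:M) *m r z.
      by rewrite mulmxBl mul1mx addrC subrK.
    apply: le_trans (ler_fnormD _ _) _; rewrite mulrDl mul1r lerD2l.
    apply: le_trans (fnorm_mulmx _ _) _.
    by rewrite ler_wpM2r ?fnorm_ge0 // fnorm_le_diam.
  have h4 := le_trans h2 (ler_wpM2l Lg0 h3).
  have h5 : fnorm (GF y) <= fnorm (GF z) + fnorm (GF y - GF z).
    by apply: le_trans (ler_fnormD _ _); rewrite [GF z + _]addrC subrK.
  apply: le_trans h5 _.
  apply: le_trans (lerD h1 h4) _.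
  by rewrite /Gl le_eqVlt; apply/orP; left; apply/eqP; ring.
have grad_point z : F z <= F x0 ->
    has_grad F z (GF z) /\ fnorm (GF z) <= gam^-1 * fnorm (r z).
  by move=> /OmL Oz; split; [exact: hG|exact: nG].
have Bxs : eball xstar rho xstar by rewrite /eball /= subrr fnorm0 ltW.
have Txs : split_op s f g gam xstar = xstar.
  by rewrite Tlin // subrr mulmx0 addr0.
have Fmin z : F xstar <= F z.
  exact: (envelope_fixpoint_min L0 fc fs gp gl gc gam0 gamL).
have decrease z : F (z - r z) <= F z - decrease_rate s L gam * fdot (r z) (r z).
  rewrite {1}/r opprB addrC subrK.
  exact: (envelope_decrease s L0 fc fs gp gl gc gam0 gamL).
have local_affine z : eball xstar rho z -> r z = (1%:M - M) *m (z - xstar).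
  by move=> Bz; rewrite /r Tlin // mulmxBl mul1mx opprD addrA.
have c0 := decrease_rate_gt0 s L0 gam0 gamL.
set c := decrease_rate s L gam in c0 decrease.
have gi0 : 0 < gam^-1 by rewrite invr_gt0.
pose e := escape_residual F x0 xstar rho gam^-1 mu_gam.
pose C1 := (F x0 - F xstar) / e ^+ 2 / c.
have C10 : 0 <= C1 by rewrite divr_ge0 ?(ltW c0) // divr_ge0 ?sqr_ge0 // subr_ge0.
have C0 : 0 <= D * Gl / c by rewrite divr_ge0 ?(ltW c0) // mulr_ge0 // ltW.
(* Both constants are chosen before [K] and the run. The [+ 1] accounts for [escape_time] being
   applied at [K0.-1], the last index outside the ball. *)
exists (D * Gl / c), (C1 + 1) => K x P K1 [x_0 P_0 run] K0.
have r_neq0 k : (k < K)%N -> r (x k) != 0.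
  by move=> /run[/eqP xT _ _]; rewrite subr_eq0.
have P_step k : (k < K)%N ->
    P k.+1 = proj cP (P k - (D / (Gl * Num.sqrt K%:R)) *: grad (step_loss F r (x k)) (P k)).
  by move=> /run[].
have x_step k : (k < K)%N -> argmin [set x k; x k - P k *m r (x k)] F (x k.+1).
  by move=> /run[].
have [hB hE] := ident_indexP (eball xstar rho) K x.
rewrite -/K0 in hB hE; split=> [|K0K].
  have [->|K0p] := posnP K0.
    by rewrite addr_ge0 ?(mulr_ge0 C0 (sqrtr_ge0 _)) // addr_ge0.
  have [mK nB] := hE K0p.
  have := escape_time Fc Fmin gi0 Gl0 rho0 mug0 grad_step grad_point decrease
    Fs cPc cPx cP1 x_0 P_0 K1 r_neq0 P_step x_step mK nB.
  rewrite mulrC -ler_pdivlMr // mulrDl -/e -/C1 => h.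
  rewrite -(prednK K0p) -natr1 addrA lerD2r addrC.
  by apply: le_trans h _; rewrite lerD2l mulrAC.
have := @local_rate _ _ F r GF cP x0 xstar M rho Gl mu_gam Fc Fmin Gl0 rho0 mug0
  grad_step local_affine Mu Fs cPc cPx cP1 cPM K x P x_0 P_0 K1 r_neq0 P_step x_step
  K0 (K - K0)%N.
by rewrite subnKC ?(ltnW K0K) // => /(_ hB (leqnn _)).
Qed.
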